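(* Let $L$ be a semiprime Lie algebra over a field $k$ of characteristic zero satisfying the standard Lie identity of degree $5$. Then there exist a semiprime commutative differential $k$-algebra $A$ and an injective homomorphism of Lie algebras over $k$ from $L$ to the Lie algebra of special derivations $\mathrm{Diff}\, A$. In particular, $L$ is Wronskian special.
   Context: A differential $k$-algebra is a commutative associative $k$-algebra $A$, not necessarily with identity, equipped with a specified $k$-linear derivation $a\mapsto a'$. A differential ideal is an ideal $I$ with $a'\in I$ for all $a\in I$. A differential algebra $A$ is semiprime if $I^2\neq 0$ for any nonzero differential ideal $I$ of $A$. The Lie algebra of special derivations of $A$ is $\mathrm{Diff}\, A=\{a\partial \mid a\in A\}$ (a copy of the vector space $A$) with bracket $[a\partial,b\partial]=(ab'-a'b)\partial$. The functor $A\mapsto \mathrm{Diff}\, A$ from commutative differential $k$-algebras to Lie $k$-algebras has a left adjoint $L\mapsto W(L)$; the Lie algebra $\mathrm{Diff}\, W(L)$ is called the Wronskian envelope of $L$. A Lie algebra $L$ is Wronskian special if the canonical homomorphism $L\to\mathrm{Diff}\, W(L)$ is injective (equivalently, by the universal property, if $L$ embeds in $\mathrm{Diff}\,A$ for some commutative differential $k$-algebra $A$). A Lie algebra $L$ is semiprime if $[I,I]\neq 0$ for any nonzero ideal $I\subset L$. A Lie algebra $L$ satisfies the standard Lie identity of degree $5$ ($\mathrm{St}_5$) if $$\sum_{\sigma\in S_4}(-1)^{\sigma}\,\mathrm{ad}\,x_{\sigma(1)}\,\mathrm{ad}\,x_{\sigma(2)}\,\mathrm{ad}\,x_{\sigma(3)}\,\mathrm{ad}\,x_{\sigma(4)}\,z=0$$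 for all $x_1,x_2,x_3,x_4,z\in L$, where $(-1)^\sigma$ is the sign of $\sigma$. *)

(* Defs.v *)
From HB Require Import structures.
From mathcomp Require Import all_boot all_fingroup all_algebra.
From mathcomp Require Import boolp classical_sets.

Set Implicit Arguments.
Unset Strict Implicit.
Unset Printing Implicit Defensive.

Import GRing.Theory.
Local Open Scope classical_set_scope.
Local Open Scope ring_scope.

(* The alternating law [lie_xx] is the standard axiom in every characteristic. *)
HB.mixin Record isLieAlgebra (k : fieldType) L of GRing.Lmodule k L := {
  lie : L -> L -> L;
  lie_linear_l : forall y, linear (lie^~ y);
  lie_linear_r : forall x, linear (lie x);
  lie_xx : forall x, lie x x = 0;
  lie_jacobi : forall x y z,
    lie x (lie y z) + lie y (lie z x) + lie z (lie x y) = 0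
}.

#[short(type="lieAlgType")]
HB.structure Definition LieAlgebra (k : fieldType) :=
  {L of GRing.Lmodule k L & isLieAlgebra k L}.

(* No identity element is required, so the algebra structures of [ssralg],
   which are all unital, do not apply. *)
HB.mixin Record isDiffAlgebra (k : fieldType) A of GRing.Lmodule k A := {
  dmul : A -> A -> A;
  der : A -> A;
  dmulC : commutative dmul;
  dmulA : associative dmul;
  dmul_linear_l : forall b, linear (dmul^~ b);
  der_linear : linear der;
  der_dmul : forall a b, der (dmul a b) = dmul (der a) b + dmul a (der b)
}.

#[short(type="diffAlgType")]
HB.structure Definition DiffAlgebra (k : fieldType) :=
  {A of GRing.Lmodule k A & isDiffAlgebra k A}.

(* [Diff A] is a copy of the vector space A; its element [a] stands for the
   special derivation a∂. *)
Definition Diff (k : fieldType) (A : diffAlgType k) : Type := A.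

Section DiffLie.
Variables (k : fieldType) (A : diffAlgType k).

HB.instance Definition _ := GRing.Lmodule.copy (Diff A) A.

Definition diff_lie (a b : Diff A) : Diff A :=
  dmul (a : A) (der (b : A)) - dmul (der (a : A)) (b : A).

Lemma dmul_linear_r (a : A) : linear (dmul a).
Proof. by move=> c x y; rewrite !(dmulC a) dmul_linear_l. Qed.

Let dmulDr (a : A) : {morph dmul a : x y / x + y}.
Proof. by move=> x y; have := dmul_linear_r a 1 x y; rewrite !scale1r. Qed.

Let dmul0r (a : A) : dmul a 0 = 0.
Proof. by apply: (addrI (dmul a 0)); rewrite -dmulDr !addr0. Qed.

Let dmulNr (a : A) : {morph dmul a : x / - x}.
Proof.
by move=> x; apply: (addrI (dmul a x)); rewrite -dmulDr !subrr dmul0r.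
Qed.

Let derD : {morph (der : A -> A) : x y / x + y}.
Proof. by move=> x y; have := der_linear 1 x y; rewrite !scale1r. Qed.

Let der0 : der (0 : A) = 0.
Proof. by apply: (addrI (der (0 : A))); rewrite -derD !addr0. Qed.

Let derN : {morph (der : A -> A) : x / - x}.
Proof. by move=> x; apply: (addrI (der x)); rewrite -derD !subrr der0. Qed.

Fact diff_lie_linear_r (a : Diff A) : linear (diff_lie a).
Proof.
move=> c x y; rewrite /diff_lie der_linear !dmul_linear_r.
by rewrite scalerBr opprD addrACA.
Qed.

Fact diff_lie_anti (a b : Diff A) : diff_lie a b = - diff_lie b a.
Proof. by rewrite /diff_lie opprB (dmulC (der b)) (dmulC (der a)). Qed.

Fact diff_lie_linear_l (b : Diff A) : linear (diff_lie^~ b).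
Proof.
move=> c x y /=; rewrite diff_lie_anti diff_lie_linear_r opprD -scalerN.
by rewrite -!diff_lie_anti.
Qed.

Fact diff_lie_xx (a : Diff A) : diff_lie a a = 0.
Proof. by rewrite /diff_lie (dmulC (der a)) subrr. Qed.

Fact diff_lie_jacobi (x y z : Diff A) :
  diff_lie x (diff_lie y z) + diff_lie y (diff_lie z x)
    + diff_lie z (diff_lie x y) = 0.
Proof.
have derE (b c : A) : der (diff_lie b c : A) =
    dmul b (der (der c)) - dmul c (der (der b)).
  rewrite /diff_lie derD derN !der_dmul (addrC (dmul (der b) _)).
  by rewrite (addrC (dmul (der (der b)) c)) opprD addrA addrK (dmulC _ c).
have E (a b c : A) : diff_lie a (diff_lie b c : A) =
    (dmul a (dmul b (der (der c))) - dmul a (dmul c (der (der b))))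
    - (dmul (der a) (dmul b (der c)) - dmul (der a) (dmul c (der b))).
  rewrite {1}/diff_lie derE /diff_lie !dmulDr !dmulNr.
  by rewrite (dmulC (der b) c).
have C (a b c : A) : dmul a (dmul b c) = dmul b (dmul a c).
  by rewrite !dmulA (dmulC a).
have R (a b c : A) : dmul a (dmul b c) = dmul c (dmul b a).
  by rewrite (dmulC a) (dmulC c) -!dmulA (dmulC a).
have Z (a b c : A) : (a - b) + (c - a) + (b - c) = 0.
  by rewrite (addrC (a - b)) subrKA -(opprB c) subrr.
rewrite !E (C y x) (C z x) (C z y) (R (der y) z) (R (der z) x) (R (der z) y).
rewrite [X in X + _ = 0]addrACA -opprD addrACA -opprD Z.
by rewrite !subrKA subrr subr0.
Qed.

HB.instance Definition _ := isLieAlgebra.Build k (Diff A)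
  diff_lie_linear_l diff_lie_linear_r diff_lie_xx diff_lie_jacobi.
End DiffLie.

Definition subspace (k : fieldType) (V : lmodType k) (S : set V) : Prop :=
  S 0 /\ forall (c : k) (u v : V), S u -> S v -> S (c *: u + v).

(* The k-span of the values [op x y] with x in I and y in J. *)
Definition span_op (k : fieldType) (V : lmodType k) (op : V -> V -> V)
    (I J : set V) : set V :=
  smallest (@subspace k V) [set op x y | x in I & y in J].

Definition lie_ideal (k : fieldType) (L : lieAlgType k) (I : set L) : Prop :=
  subspace I /\ (forall x y : L, I y -> I (lie x y)).

Definition lie_semiprime (k : fieldType) (L : lieAlgType k) : Prop :=
  forall I : set L, lie_ideal I -> I <> [set 0] -> span_op lie I I <> [set 0].

(* Ideals of a k-algebra without identity are k-subspaces by definition. *)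
Definition diff_ideal (k : fieldType) (A : diffAlgType k) (I : set A) : Prop :=
  [/\ subspace I,
      forall a b : A, I b -> I (dmul a b) &
      forall a : A, I a -> I (der a)].

Definition diff_semiprime (k : fieldType) (A : diffAlgType k) : Prop :=
  forall I : set A, diff_ideal I -> I <> [set 0] -> span_op dmul I I <> [set 0].

Definition lie_morphism (k : fieldType) (L M : lieAlgType k)
    (f : {linear L -> M}) : Prop :=
  {morph f : x y / lie x y}.

Definition diff_morphism (k : fieldType) (A B : diffAlgType k)
    (g : {linear A -> B}) : Prop :=
  {morph g : a b / dmul a b} /\ {morph g : a / der a}.

(* [W] with unit [iota] is the value at [L] of the left adjoint of [Diff]:
   every Lie homomorphism [L -> Diff A] factors through [iota] by a unique
   morphism of differential algebras. [Diff g] is [g] on underlying spaces. *)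
Definition wronskian_envelope (k : fieldType) (L : lieAlgType k)
    (W : diffAlgType k) (iota : {linear L -> Diff W}) : Prop :=
  lie_morphism iota /\
  forall (A : diffAlgType k) (f : {linear L -> Diff A}), lie_morphism f ->
    exists g : {linear W -> A},
      [/\ diff_morphism g,
          forall x : L, g (iota x) = f x &
          forall h : {linear W -> A},
            diff_morphism h -> (forall x : L, h (iota x) = f x) -> h =1 g].

(* The pair (W, iota) is unique up to isomorphism, so injectivity of iota does
   not depend on its choice. *)
Definition wronskian_special (k : fieldType) (L : lieAlgType k) : Prop :=
  exists (W : diffAlgType k) (iota : {linear L -> Diff W}),
    wronskian_envelope iota /\ injective iota.

Definition ad (k : fieldType) (L : lieAlgType k) (x : L) : L -> L := lie x.

(* St_5: x_1, ..., x_4 are indexed by 'I_4, and [(-1) ^+ s] is the sign of s. *)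
Definition standard_lie_identity5 (k : fieldType) (L : lieAlgType k) : Prop :=
  forall (x : 'I_4 -> L) (z : L),
    \sum_(s : 'S_4) (-1) ^+ s *:
      ad (x (s (inord 0))) (ad (x (s (inord 1)))
        (ad (x (s (inord 2))) (ad (x (s (inord 3))) z))) = 0.

(* Main.v *)
From HB Require Import structures.
Require Import Defs.
From mathcomp Require Import all_boot all_fingroup all_algebra.
From mathcomp Require Import zify ring.
From mathcomp Require Import boolp classical_sets functions.

(* For [T x y z := lie_std3 x y z = s_3 (ad x, ad y, ad z)], the identity St_5 makes every
   [T x y z] a 1/2-derivation, [2 T [u, v] = [T u, v] + [u, T v]], and semiprimeness makes these
   operators commute; they generate a commutative algebra [E] on which [L] acts by
   derivations [D u f = [ad u, f]] that are pairwise proportional: [D u f v = D v f u].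

   A linear [j : L -> R] into a commutative algebra with
   [j x j [y, z] + j y j [z, x] + j z j [x, y] = 0] yields a Lie homomorphism
   [v |-> j (exp (t ad u) v) / j u] into [Diff R[1 / j u][[t]]], and any [v] in its kernel
   satisfies [j u ^ n j v = 0] for some [n]. Let [v] be killed by all homomorphisms into
   algebras [Diff A].
   - For [j x = D x f] with [f] in [E], and after a product over a sequence of choices of [f]
     and [u] (elements of [E] may be nilpotent, so no single choice is enough), one gets
     [D v = 0].
   - The elements with [D v = 0] form an ideal on which [E] acts by centroid elements and
     [L] looks like a form of sl_2; there [j] is given by an isotropic vector, which exists
     after adjoining one square root to [E].
   The remaining elements form a solvable ideal, which vanishes. So [L] embeds into the
   universal [Diff (W L)]. Dividing [W L] by a maximal differential ideal avoiding [L] gives a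
   semiprime algebra, because [L] is semiprime. *)

Set Implicit Arguments.
Unset Strict Implicit.
Unset Printing Implicit Defensive.

Import GRing.Theory.
Local Open Scope classical_set_scope.
Local Open Scope ring_scope.

(** * Bilinearity and the Leibniz form of Jacobi's identity *)

Section LieBasics.
Variables (k : fieldType) (L : lieAlgType k).
Implicit Types x y z w : L.

Lemma lieDl x y z : lie (x + y) z = lie x z + lie y z.
Proof. by have := lie_linear_l z 1 x y; rewrite !scale1r. Qed.
Lemma lieDr x y z : lie z (x + y) = lie z x + lie z y.
Proof. by have := lie_linear_r z 1 x y; rewrite !scale1r. Qed.
Lemma lie0l z : lie 0 z = 0 :> L.
Proof. by apply: (addrI (lie 0 z)); rewrite -lieDl !addr0. Qed.
Lemma lie0r z : lie z 0 = 0 :> L.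
Proof. by apply: (addrI (lie z 0)); rewrite -lieDr !addr0. Qed.
Lemma lieZl c x z : lie (c *: x) z = c *: lie x z.
Proof. by have := lie_linear_l z c x 0; rewrite lie0l !addr0. Qed.
Lemma lieZr c x z : lie z (c *: x) = c *: lie z x.
Proof. by have := lie_linear_r z c x 0; rewrite lie0r !addr0. Qed.
Lemma lieNl x z : lie (- x) z = - lie x z.
Proof. by rewrite -scaleN1r lieZl scaleN1r. Qed.
Lemma lieNr x z : lie z (- x) = - lie z x.
Proof. by rewrite -scaleN1r lieZr scaleN1r. Qed.
Lemma lieC x y : lie x y = - lie y x.
Proof.
apply/eqP; rewrite -addr_eq0; apply/eqP.
by have := lie_xx (x + y); rewrite lieDl !lieDr !lie_xx addr0 add0r addrC.
Qed.
Lemma lie_derl x y z : lie (lie x y) z = lie x (lie y z) - lie y (lie x z).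
Proof.
have := lie_jacobi x y z; rewrite (lieC z (lie x y)) (lieC z x) lieNr => /eqP.
by rewrite subr_eq0 => /eqP <-.
Qed.
Lemma lieMnl x z n : lie (x *+ n) z = lie x z *+ n.
Proof. by elim: n => [|n IHn]; rewrite ?mulr0n ?lie0l // !mulrSr lieDl IHn. Qed.
Lemma lieMnr x z n : lie z (x *+ n) = lie z x *+ n.
Proof. by elim: n => [|n IHn]; rewrite ?mulr0n ?lie0r // !mulrSr lieDr IHn. Qed.

End LieBasics.

(** * Deciding Lie identities *)

Inductive lie_mono := MVar of nat | MLie of lie_mono & lie_mono.

Inductive lie_term :=
  | TZero
  | TVar of nat
  | TAdd of lie_term & lie_term
  | TOpp of lie_term
  | TMuln of lie_term & nat
  | TLie of lie_term & lie_term.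

Section LieReflection.
Variables (k : fieldType) (L : lieAlgType k) (e : seq L).

Definition signed (b : bool) (x : L) : L := if b then - x else x.

Fixpoint mono_eval m : L :=
  match m with
  | MVar i => nth 0 e i
  | MLie m1 m2 => lie (mono_eval m1) (mono_eval m2)
  end.

Fixpoint term_eval t : L :=
  match t with
  | TZero => 0
  | TVar i => nth 0 e i
  | TAdd t1 t2 => term_eval t1 + term_eval t2
  | TOpp t1 => - term_eval t1
  | TMuln t1 n => term_eval t1 *+ n
  | TLie t1 t2 => lie (term_eval t1) (term_eval t2)
  end.

Definition flip_signs T (s : seq (bool * T)) := [seq (~~ p.1, p.2) | p <- s].

Fixpoint term_monos t : seq (bool * lie_mono) :=
  match t with
  | TZero => [::]
  | TVar i => [:: (false, MVar i)]
  | TAdd t1 t2 => term_monos t1 ++ term_monos t2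
  | TOpp t1 => flip_signs (term_monos t1)
  | TMuln t1 n => flatten (nseq n (term_monos t1))
  | TLie t1 t2 =>
      [seq (p.1 (+) q.1, MLie p.2 q.2) | p <- term_monos t1, q <- term_monos t2]
  end.

Fixpoint mono_min m := match m with
  | MVar i => i | MLie m1 m2 => minn (mono_min m1) (mono_min m2) end.

Fixpoint mono_mem i m := match m with
  | MVar j => i == j | MLie m1 m2 => mono_mem i m1 || mono_mem i m2 end.

(* The expansion of [ad m] as a combination of words in the [ad x_i]. *)
Fixpoint mono_ad m : seq (bool * seq nat) :=
  match m with
  | MVar i => [:: (false, [:: i])]
  | MLie m1 m2 =>
      [seq (p.1 (+) q.1, p.2 ++ q.2) | p <- mono_ad m1, q <- mono_ad m2] ++
      [seq (~~ (p.1 (+) q.1), p.2 ++ q.2) | p <- mono_ad m2, q <- mono_ad m1]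
  end.

(* Right-normed words ending in the letter [i]; they form a basis of the
   multilinear part of the free Lie algebra. *)
Fixpoint mono_nf i m : seq (bool * (seq nat * nat)) :=
  match m with
  | MVar j => [:: (false, ([::], j))]
  | MLie m1 m2 =>
      if mono_mem i m2 then
        [seq (p.1 (+) q.1, (p.2 ++ q.2.1, q.2.2)) | p <- mono_ad m1, q <- mono_nf i m2]
      else
        [seq (~~ (p.1 (+) q.1), (p.2 ++ q.2.1, q.2.2)) | p <- mono_ad m2, q <- mono_nf i m1]
  end.

(** Each monomial is normalized at its smallest letter, so that monomials in the same letters end in
    the same one. With repeated letters the normal form need not be unique, but the test stays
    sound. *)
Definition term_nf t : seq (bool * (seq nat * nat)) :=
  flatten [seq [seq (p.1 (+) q.1, q.2) | q <- mono_nf (mono_min p.2) p.2]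
          | p <- term_monos t].

Definition lie_check t : bool :=
  let s := term_nf t in
  perm_eq [seq p.2 | p <- s & p.1] [seq p.2 | p <- s & ~~ p.1].

Definition word_eval (w : seq nat) (x : L) : L :=
  foldr (fun i => lie (nth 0 e i)) x w.

Lemma signed_signed a b x : signed a (signed b x) = signed (a (+) b) x.
Proof. by case: a b => [] []; rewrite /= ?opprK. Qed.

Lemma signed_sum b I (r : seq I) F :
  signed b (\sum_(i <- r) F i) = \sum_(i <- r) signed b (F i).
Proof. by case: b; rewrite /= ?sumrN. Qed.

Lemma signedN b x : signed (~~ b) x = - signed b x.
Proof. by case: b; rewrite /= ?opprK. Qed.

Lemma lie_signedl b x y : lie (signed b x) y = signed b (lie x y).
Proof. by case: b; rewrite /= ?lieNl. Qed.

Lemma lie_signedr b x y : lie x (signed b y) = signed b (lie x y).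
Proof. by case: b; rewrite /= ?lieNr. Qed.

Lemma lie_suml I (r : seq I) F y :
  lie (\sum_(i <- r) F i) y = \sum_(i <- r) lie (F i) y :> L.
Proof.
by elim: r => [|i r IHr]; rewrite ?big_nil ?lie0l // !big_cons lieDl IHr.
Qed.

Lemma lie_sumr I (r : seq I) F y :
  lie y (\sum_(i <- r) F i) = \sum_(i <- r) lie y (F i) :> L.
Proof.
by elim: r => [|i r IHr]; rewrite ?big_nil ?lie0r // !big_cons lieDr IHr.
Qed.

Lemma word_eval_signed w b x : word_eval w (signed b x) = signed b (word_eval w x).
Proof. by elim: w => //= i w ->; rewrite lie_signedr. Qed.

Lemma word_eval_sum w I (r : seq I) F :
  word_eval w (\sum_(i <- r) F i) = \sum_(i <- r) word_eval w (F i).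
Proof. by elim: w => //= i w ->; rewrite lie_sumr. Qed.

Lemma word_eval_cat w1 w2 x : word_eval (w1 ++ w2) x = word_eval w1 (word_eval w2 x).
Proof. by rewrite /word_eval foldr_cat. Qed.

Lemma term_monosP t :
  term_eval t = \sum_(p <- term_monos t) signed p.1 (mono_eval p.2).
Proof.
elim: t => [|i|t1 IH1 t2 IH2|t1 IH1|t1 IH1 n|t1 IH1 t2 IH2] /=.
- by rewrite big_nil.
- by rewrite big_seq1.
- by rewrite big_cat IH1 IH2.
- by rewrite big_map IH1 -sumrN; apply: eq_bigr => p _; rewrite signedN.
- rewrite IH1; elim: n => [|n IHn]; rewrite ?big_nil ?mulr0n //=.
  by rewrite big_cat /= -IHn mulrS.
rewrite big_allpairs_dep IH1 lie_suml; apply: eq_bigr => p _.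
rewrite IH2 lie_sumr; apply: eq_bigr => q _ /=.
by rewrite lie_signedl lie_signedr signed_signed.
Qed.

Lemma mono_adP m x :
  lie (mono_eval m) x = \sum_(p <- mono_ad m) signed p.1 (word_eval p.2 x).
Proof.
elim: m x => [i|m1 IH1 m2 IH2] x /=; first by rewrite big_seq1.
rewrite lie_derl (IH1 (lie _ x)) (IH2 (lie _ x)) big_cat /= !big_allpairs_dep.
congr (_ + _).
  apply: eq_bigr => p _; rewrite IH2 word_eval_sum signed_sum.
  by apply: eq_bigr => q _; rewrite word_eval_signed signed_signed word_eval_cat.
rewrite -sumrN; apply: eq_bigr => p _; rewrite IH1 word_eval_sum signed_sum -sumrN.
apply: eq_bigr => q _.
by rewrite word_eval_signed signed_signed word_eval_cat signedN.
Qed.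

Lemma mono_nfP i m : mono_eval m =
  \sum_(p <- mono_nf i m) signed p.1 (word_eval p.2.1 (nth 0 e p.2.2)).
Proof.
elim: m => [j|m1 IH1 m2 IH2] /=; first by rewrite big_seq1.
case: ifP => _; rewrite big_allpairs_dep.
  rewrite mono_adP; apply: eq_bigr => p _.
  rewrite {1}IH2 word_eval_sum signed_sum; apply: eq_bigr => q _.
  by rewrite word_eval_signed signed_signed word_eval_cat.
rewrite lieC mono_adP -sumrN; apply: eq_bigr => p _.
rewrite {1}IH1 word_eval_sum signed_sum -sumrN; apply: eq_bigr => q _.
by rewrite word_eval_signed signed_signed word_eval_cat signedN.
Qed.

Lemma lie_checkP t : lie_check t -> term_eval t = 0.
Proof.
have -> : term_eval t =
    \sum_(p <- term_nf t) signed p.1 (word_eval p.2.1 (nth 0 e p.2.2)).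
  rewrite term_monosP big_flatten /= big_map; apply: eq_bigr => p _.
  rewrite (mono_nfP (mono_min p.2)) signed_sum big_map; apply: eq_bigr => q _.
  by rewrite signed_signed.
rewrite /lie_check; move: (term_nf t) => s eqs.
rewrite (bigID fst) /= -[X in X + _]big_filter -[X in _ + X]big_filter.
rewrite (eq_big_seq (fun p => - word_eval p.2.1 (nth 0 e p.2.2))); last first.
  by move=> p; rewrite mem_filter => /andP[->].
rewrite [X in _ + X](eq_big_seq (fun p => word_eval p.2.1 (nth 0 e p.2.2))).
  rewrite sumrN; apply/eqP; rewrite addrC subr_eq0; apply/eqP.
  have := perm_big _ eqs (op := +%R) (x := 0) (P := xpredT)
    (F := fun q => word_eval q.1 (nth 0 e q.2)).
  by rewrite !big_map => ->.
by move=> p; rewrite mem_filter => /andP[/negPf->].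
Qed.

End LieReflection.

(* Scaled atoms are compared through their arguments, since their module structures may be
   convertible but syntactically different. *)
Ltac lie_same x y := let _ := match goal with _ => constr_eq x y end in constr:(tt).

Ltac lie_same_atom x y :=
  match constr:((x, y)) with
  | _ => lie_same x y
  | (@GRing.scale _ _ ?c ?u, @GRing.scale _ _ ?d ?v) =>
      let _ := lie_same c d in lie_same u v
  end.

Ltac lie_atom x e :=
  lazymatch e with
  | nil => constr:((0%N, [:: x]))
  | cons ?y ?s =>
      match constr:(tt) with
      | _ => let _ := lie_same_atom x y in constr:((0%N, e))
      | _ => lazymatch lie_atom x s with (?n, ?s') => constr:((n.+1, cons y s')) end
      end
  end.

Ltac lie_reify t e :=
  lazymatch t with
  | 0 => constr:((TZero, e))
  | ?a + ?b =>
      lazymatch lie_reify a e with (?a', ?e1) =>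
      lazymatch lie_reify b e1 with (?b', ?e2) => constr:((TAdd a' b', e2)) end end
  | - ?a => lazymatch lie_reify a e with (?a', ?e1) => constr:((TOpp a', e1)) end
  | ?a *+ ?n => lazymatch lie_reify a e with (?a', ?e1) => constr:((TMuln a' n, e1)) end
  | lie ?a ?b =>
      lazymatch lie_reify a e with (?a', ?e1) =>
      lazymatch lie_reify b e1 with (?b', ?e2) => constr:((TLie a' b', e2)) end end
  | _ => lazymatch lie_atom t e with (?n, ?e1) => constr:((TVar n, e1)) end
  end.

Ltac lie_ring :=
  apply/eqP; rewrite -subr_eq0; apply/eqP;
  lazymatch goal with |- @eq ?T ?t _ =>
    lazymatch lie_reify t (@nil T) with (?t', ?e) =>
      exact: (@lie_checkP _ _ e t' (erefl true <: lie_check t' = true))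
    end
  end.

(** * The standard polynomials and St_5 *)

(** A permutation amounts to the image of the first letter and a permutation of the others;
    iterating this turns a sum over ['S_4] into 24 explicit terms. *)
Lemma sum_perm_lift (V : nmodType) n (F : 'S_n.+1 -> V) :
  \sum_s F s = \sum_i \sum_(s : 'S_n) F (lift_perm ord0 i s).
Proof.
pose h (p : 'I_n.+1 * 'S_n) := lift_perm ord0 p.1 p.2.
have injh : injective h.
  move=> [i s] [j t] /permP eqh.
  have /= eij := eqh ord0; rewrite /h !lift_perm_id /= in eij.
  rewrite -{}eij in eqh *; congr pair; apply/permP => l.
  by have := eqh (lift ord0 l); rewrite /h !lift_perm_lift => /lift_inj.
rewrite pair_bigA (reindex h) //=; apply: onW_bij.
by apply: inj_card_bij => //; rewrite card_prod card_ord !card_Sn factS.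
Qed.

Lemma sum_perm0 (V : nmodType) (F : 'S_0 -> V) : \sum_s F s = F 1%g.
Proof. by rewrite (bigD1 1%g) //= big1 ?addr0 // => s; rewrite (permS0 s) eqxx. Qed.

Section St5.
Variables (k : fieldType) (L : lieAlgType k) (St5 : standard_lie_identity5 L).

(* By Jacobi's identity, this is [s_3 (ad x, ad y, ad z) w]. *)
Definition lie_std3 (x y z w : L) : L :=
  lie (lie x y) (lie z w) + lie (lie y z) (lie x w) + lie (lie z x) (lie y w).

(** Expansion of [s_4 (ad x, ad y, ad z, ad u) w] along the left factor. *)
Definition lie_std4 (x y z u w : L) : L :=
  lie x (lie_std3 y z u w) - lie y (lie_std3 x z u w)
  + lie z (lie_std3 x y u w) - lie u (lie_std3 x y z w).

Lemma lie_std4_eq0 x y z u w : lie_std4 x y z u w = 0.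
Proof.
have := St5 (fun i => nth 0 [:: x; y; z; u] i) w.
have -> : inord 0 = ord0 :> 'I_4 by apply/val_inj; rewrite /= inordK.
have -> : inord 1 = lift ord0 ord0 :> 'I_4 by apply/val_inj; rewrite /= inordK.
have -> : inord 2 = lift ord0 (lift ord0 ord0) :> 'I_4.
  by apply/val_inj; rewrite /= inordK.
have -> : inord 3 = lift ord0 (lift ord0 (lift ord0 ord0)) :> 'I_4.
  by apply/val_inj; rewrite /= inordK.
rewrite /ad; do 4! rewrite !sum_perm_lift !(big_ord_recl, big_ord0).
rewrite !sum_perm0.
rewrite !odd_lift_perm !odd_perm1 !(lift_perm_lift, lift_perm_id) /=.
rewrite !(expr0, expr1, scaleN1r, scale1r) => h.
by rewrite -[RHS]h /lie_std4 /lie_std3; lie_ring.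
Qed.

(** Expansion along the right factor; it equals minus [lie_std4]. *)
Definition lie_std4r (x y z u w : L) : L :=
  lie_std3 y z u (lie x w) - lie_std3 x z u (lie y w)
  + lie_std3 x y u (lie z w) - lie_std3 x y z (lie u w).

Lemma lie_std4r_eq0 x y z u w : lie_std4r x y z u w = 0.
Proof.
rewrite -[RHS]oppr0 -(lie_std4_eq0 x y z u w) /lie_std4r /lie_std4 /lie_std3.
by lie_ring.
Qed.

Definition half_derivation (f : L -> L) : Prop :=
  forall u v, f (lie u v) *+ 2 = lie (f u) v + lie u (f v).

(** In the combination of four expansions below, the terms in [lie_std3 x y z] give the defect of a
    1/2-derivation once, and the other terms give it once more. *)
Lemma lie_std3_half2 x y z u v :
  (lie_std3 x y z (lie u v) *+ 2
   - (lie (lie_std3 x y z u) v + lie u (lie_std3 x y z v))) *+ 2 = 0.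
Proof.
transitivity (lie_std4 x y z u v - lie_std4 x y z v u
  + (lie_std4r x y z v u - lie_std4r x y z u v)).
  by rewrite /lie_std4 /lie_std4r /lie_std3; lie_ring.
by rewrite !lie_std4_eq0 !lie_std4r_eq0 !subrr addr0.
Qed.
End St5.

(** * Characteristic zero, linear maps and subspaces *)

Section Char0.
Variables (k : fieldType) (V : lmodType k).
Hypothesis char0 : [pchar k] =i pred0.

Lemma natr_char0 n : (n.+1%:R : k) != 0.
Proof. by rewrite (pcharf0P k).1. Qed.

Lemma mulrn_char0 n (x : V) : x *+ n.+1 = 0 -> x = 0.
Proof.
move=> /eqP; rewrite -scaler_nat scaler_eq0 (negPf (natr_char0 n)).
by move=> /eqP.
Qed.

End Char0.

Section LinearFun.
Variables (k : fieldType) (U V : lmodType k) (f : U -> V).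
Hypothesis lf : linear f.

Lemma linear_funD : {morph f : x y / x + y}.
Proof. by move=> x y; have := lf 1 x y; rewrite !scale1r. Qed.
Lemma linear_fun0 : f 0 = 0.
Proof. by apply: (addrI (f 0)); rewrite -linear_funD !addr0. Qed.
Lemma linear_funZ c : {morph f : x / c *: x}.
Proof. by move=> x; have := lf c x 0; rewrite linear_fun0 !addr0. Qed.
Lemma linear_funN : {morph f : x / - x}.
Proof. by move=> x; rewrite -scaleN1r linear_funZ scaleN1r. Qed.
Lemma linear_funB : {morph f : x y / x - y}.
Proof. by move=> x y; rewrite linear_funD linear_funN. Qed.
Lemma linear_funMn n : {morph f : x / x *+ n}.
Proof. by move=> x; rewrite -!scaler_nat linear_funZ. Qed.
End LinearFun.

Section Subspace.
Variables (k : fieldType) (V : lmodType k) (S : set V).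
Hypothesis subS : subspace S.

Lemma subspace0 : S 0. Proof. by case: subS. Qed.
Lemma subspaceZ c x : S x -> S (c *: x).
Proof. by case: subS => S0 SD Sx; rewrite -[_ *: _]addr0; apply: SD. Qed.
Lemma subspaceD x y : S x -> S y -> S (x + y).
Proof. by case: subS => S0 SD Sx Sy; rewrite -[x]scale1r; apply: SD. Qed.
Lemma subspaceN x : S x -> S (- x).
Proof. by rewrite -scaleN1r; apply: subspaceZ. Qed.
Lemma subspaceB x y : S x -> S y -> S (x - y).
Proof. by move=> Sx Sy; apply/subspaceD/subspaceN. Qed.
End Subspace.

(** * Ideals of semiprime Lie algebras *)

Lemma span_op_eq0 (k : fieldType) (V : lmodType k) (op : V -> V -> V) (I : set V) :
  (forall x y, I x -> I y -> op x y = 0) -> span_op op I I = [set 0].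
Proof.
move=> opI; apply/seteqP; split=> [x | x ->]; last by move=> S [[]].
apply; split.
  split=> [//|c u v -> ->]; by rewrite /= scaler0 addr0.
by move=> _ [u Iu [v Iv <-]]; rewrite /= opI.
Qed.

Section Semiprime.
Variables (k : fieldType) (L : lieAlgType k).
Hypothesis semiprimeL : lie_semiprime L.

Lemma lie_idealr (I : set L) x y : lie_ideal I -> I x -> I (lie x y).
Proof.
by move=> [sI iI] Ix; rewrite lieC; apply: subspaceN => //; apply: iI.
Qed.

Lemma abelian_ideal_eq0 (I : set L) : lie_ideal I ->
  (forall x y, I x -> I y -> lie x y = 0) -> forall x, I x -> x = 0.
Proof.
move=> iI abI x Ix; apply: contrapT => x0.
have := semiprimeL iI; rewrite span_op_eq0 // => /(_ _ erefl); apply.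
by move=> I0; apply: x0; rewrite I0 in Ix.
Qed.

(** Let [Z1] be the centralizer of [[I, I]] in [I]. Brackets of [Z1] lie in [[I, I]], hence in the
    center [Z2] of [Z1]. So [Z2], and then [Z1], is an abelian ideal and vanishes. *)
Lemma centralizer_derived_eq0 (I : set L) x : lie_ideal I -> I x ->
  (forall p q, I p -> I q -> lie (lie p q) x = 0) -> x = 0.
Proof.
move=> iI; move: x; have [sI lI] := iI.
pose Z1 := [set x | I x /\ forall p q, I p -> I q -> lie (lie p q) x = 0].
have iZ1 : lie_ideal Z1.
  split=> [|u x [Ix Zx]]; first split.
  - by split=> [|p q _ _]; rewrite ?lie0r //; apply: subspace0.
  - move=> c u v [Iu Zu] [Iv Zv]; split; first by case: sI => _; apply.
    by move=> p q Ip Iq; rewrite lieDr lieZr Zu ?Zv ?scaler0 ?addr0.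
  split=> [|p q Ip Iq]; first exact: lI.
  have -> : lie (lie p q) (lie u x) =
      lie u (lie (lie p q) x) - lie (lie (lie u p) q) x - lie (lie p (lie u q)) x.
    by lie_ring.
  by rewrite !Zx ?lie0r ?subr0 //; apply: lI.
pose Z2 := [set x | Z1 x /\ forall y, Z1 y -> lie x y = 0].
have iZ2 : lie_ideal Z2.
  split=> [|u x [Ix Zx]]; first split.
  - by split=> [|p _]; rewrite ?lie0l //; apply: subspace0; case: iZ1.
  - move=> c u v [Iu Zu] [Iv Zv]; split; first by case: iZ1 => -[_ D _]; apply: D.
    by move=> p Ip; rewrite lieDl lieZl Zu ?Zv ?scaler0 ?addr0.
  split=> [|p Zp]; first by apply: iZ1.2.
  rewrite lie_derl !Zx ?lie0r ?subr0 //; exact: iZ1.2.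
have Z20 x : Z2 x -> x = 0.
  by apply: (abelian_ideal_eq0 iZ2) => {}x y [_ Zx] [Zy _]; apply: Zx.
suff Z10 x : Z1 x -> x = 0 by move=> x Ix Zx; apply: Z10.
apply: (abelian_ideal_eq0 iZ1) => {}x y [Ix Zx] [Iy Zy]; apply: Z20; split.
  by apply: iZ1.2.
by move=> z [_ Zz]; apply: Zz.
Qed.

Lemma metabelian_ideal_eq0 (I : set L) x : lie_ideal I -> I x ->
  (forall p q r s, I p -> I q -> I r -> I s -> lie (lie p q) (lie r s) = 0) ->
  x = 0.
Proof.
move=> iI Ix mI; move: x Ix; apply: (abelian_ideal_eq0 iI) => x y Ix Iy.
apply: (centralizer_derived_eq0 iI) => [|p q Ip Iq]; first exact: iI.2.
exact: mI.
Qed.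

End Semiprime.

(** * Commutation of the standard operators *)

Section StandardOperators.
Variables (k : fieldType) (L : lieAlgType k).
Hypotheses (char0 : [pchar k] =i pred0) (semiprimeL : lie_semiprime L)
  (St5 : standard_lie_identity5 L).
Local Notation T := (@lie_std3 k L).

Lemma lie_std3_linear x y z : linear (T x y z).
Proof.
by move=> c u v; rewrite /lie_std3 !lieDr !lieZr !scalerDr; lie_ring.
Qed.

Lemma lie_std3_half x y z : half_derivation (T x y z).
Proof.
by move=> u v; apply/subr0_eq/(mulrn_char0 char0)/lie_std3_half2.
Qed.

(** Every summand of [lie_std3 x y z w] is a bracket of two brackets, so [4 f] acts on it as the sum
    of [f] over its four arguments. *)
Lemma half_lie_std3 (f : L -> L) x y z w : linear f -> half_derivation f ->
  T (f x) y z w + T x (f y) z w + T x y (f z) w = f (T x y z w) *+ 4 - T x y z (f w).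
Proof.
move=> lf hf.
have f4 p q r s : f (lie (lie p q) (lie r s)) *+ 4 =
    lie (lie (f p) q) (lie r s) + lie (lie p (f q)) (lie r s)
    + lie (lie p q) (lie (f r) s) + lie (lie p q) (lie r (f s)).
  by rewrite (mulrnA _ 2 2) hf mulrnDl -lieMnl -lieMnr !hf; lie_ring.
by rewrite /lie_std3 !(linear_funD lf) !mulrnDl !f4; lie_ring.
Qed.

Lemma half_derivationD f g : half_derivation f -> half_derivation g ->
  half_derivation (fun w : L => f w + g w).
Proof. by move=> hf hg u v; rewrite mulrnDl hf hg lieDl lieDr addrACA. Qed.

Lemma half_derivationN f : half_derivation f -> half_derivation (fun w : L => - f w).
Proof. by move=> hf u v; rewrite mulNrn hf lieNl lieNr opprD. Qed.

(* [5 [f, T x y z]] is a difference of sums of operators [T], so the commutator is both a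
   1/2-derivation and, as a commutator of 1/2-derivations, a 1/4-derivation. *)
Lemma lie_std3_comm a b c x y z w :
  T a b c (T x y z w) = T x y z (T a b c w).
Proof.
pose K v := T a b c (T x y z v) - T x y z (T a b c v).
have [lS lT] := (lie_std3_linear a b c, lie_std3_linear x y z).
have [hS hT] := (lie_std3_half a b c, lie_std3_half x y z).
set S := T a b c in K lS hS *; set T' := T x y z in K lT hT *.
have K5 : half_derivation (fun v => K v *+ 5).
  have -> : (fun v => K v *+ 5) = fun v =>
      (T (S x) y z v + T x (S y) z v + T x y (S z) v)
      - (T (T' a) b c v + T a (T' b) c v + T a b (T' c) v).
    apply/funext => v; rewrite (half_lie_std3 x y z v lS hS).
    by rewrite (half_lie_std3 a b c v lT hT) -/S -/T' /K; lie_ring.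
  apply: half_derivationD; last apply: half_derivationN.
    by apply: half_derivationD; [apply: half_derivationD|]; apply: lie_std3_half.
  by apply: half_derivationD; [apply: half_derivationD|]; apply: lie_std3_half.
clearbody S T'.
have K4 u v : K (lie u v) *+ 4 = lie (K u) v + lie u (K v).
  rewrite /K (mulrnA _ 2 2) !mulrnBl -(linear_funMn lS) -(linear_funMn lT 2 (S _)) hS hT.
  rewrite (linear_funD lS) (linear_funD lT) !mulrnDl !hS !hT; lie_ring.
(* The 1/2-derivation [5 K] gives [10 K [u, v] = 5 ([K u, v] + [u, K v])], and by [K4] the right
   side is [20 K [u, v]]. *)
have K0 u v : K (lie u v) = 0.
  apply: (mulrn_char0 char0 (n := 9)).
  have := K5 u v; rewrite lieMnl lieMnr -mulrnDl -K4 => e.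
  have -> : K (lie u v) *+ 10 = K (lie u v) *+ 4 *+ 5 - K (lie u v) *+ 5 *+ 2 by lie_ring.
  by rewrite e subrr.
apply: subr0_eq; rewrite -/(K w).
(* As [K] kills brackets, [K4] at [[p, q]] and [w] gives [[[p, q], K w] = 0]. *)
apply: (centralizer_derived_eq0 semiprimeL (I := setT)) => // p q _ _.
have := K4 (lie p q) w; rewrite !K0 mul0rn lie0l add0r => <-.
by [].
Qed.

End StandardOperators.

(** * Half-derivations and the commutative algebra of standard operators *)

(** The hypotheses are bundled with the algebra because the commutative ring structure on [std_alg]
    depends on them. *)
Record st5_data (k : fieldType) := St5Data {
  st5_lie :> lieAlgType k;
  st5_char0 : [pchar k] =i pred0;
  st5_semiprime : lie_semiprime st5_lie;
  st5_identity : standard_lie_identity5 st5_lie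
}.

Section StandardAlgebra.
Variables (k : fieldType) (L : st5_data k).
Implicit Types (u v w x y z : L) (f g : L -> L).
Local Notation T := (@lie_std3 k L).

Inductive std_op : (L -> L) -> Prop :=
  | std_op_id : std_op (fun w => w)
  | std_op_gen x y z : std_op (T x y z)
  | std_opD f g : std_op f -> std_op g -> std_op (fun w => f w + g w)
  | std_opZ c f : std_op f -> std_op (fun w => c *: f w)
  | std_op_comp f g : std_op f -> std_op g -> std_op (fun w => f (g w)).

Definition ad_der u f w := lie u (f w) - f (lie u w).

Lemma std_op_linear f : std_op f -> linear f.
Proof.
elim=> [|x y z|{}f g _ lf _ lg|a {}f _ lf|{}f g _ lf _ lg] c u v //.
- exact: lie_std3_linear.
- by rewrite lf lg scalerDr addrACA.
- by rewrite lf scalerDr !scalerA mulrC.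
- by rewrite lg lf.
Qed.

Lemma std_op_comm f g w : std_op f -> std_op g -> f (g w) = g (f w).
Proof.
move=> Qf Qg; elim: Qf w => [|x y z|{}f f' Qf IHf _ IHf'|a {}f Qf IHf|{}f f' _ IHf _ IHf'] w //.
- elim: Qg w => [|x' y' z'|{}g g' _ IHg _ IHg'|a {}g _ IHg|{}g g' _ IHg _ IHg'] w //.
  + by apply: lie_std3_comm; [exact: st5_char0|exact: st5_semiprime|exact: st5_identity].
  + by rewrite linear_funD ?IHg ?IHg' //; exact: lie_std3_linear.
  + by rewrite linear_funZ ?IHg //; exact: lie_std3_linear.
  + by rewrite IHg IHg'.
- by rewrite IHf IHf' linear_funD //; exact: std_op_linear.
- by rewrite IHf linear_funZ //; exact: std_op_linear.
- by rewrite IHf' IHf.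
Qed.

(** Commutation with [ad u] is a derivation of operators, and on a generator it acts on the three
    indices. *)
Lemma ad_der_std_op u f : std_op f -> std_op (ad_der u f).
Proof.
elim=> [|x y z|{}f g Qf Df Qg Dg|a {}f Qf Df|{}f g Qf Df Qg Dg].
- rewrite (_ : ad_der _ _ = fun w => 0 *: w); first exact/std_opZ/std_op_id.
  by apply/funext => w; rewrite /ad_der subrr scale0r.
- rewrite (_ : ad_der _ _ =
    fun w => (T (lie u x) y z w + T x (lie u y) z w) + T x y (lie u z) w).
    by apply: (std_opD (f := fun w => _ + _)); [apply: std_opD|]; exact: std_op_gen.
  by apply/funext => w; rewrite /ad_der /lie_std3; lie_ring.
- rewrite (_ : ad_der _ _ = fun w => ad_der u f w + ad_der u g w); first exact: std_opD.
  by apply/funext => w; rewrite /ad_der; lie_ring.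
- rewrite (_ : ad_der _ _ = fun w => a *: ad_der u f w); first exact: std_opZ.
  by apply/funext => w; rewrite /ad_der lieZr scalerBr.
- rewrite (_ : ad_der _ _ = fun w => ad_der u f (g w) + f (ad_der u g w)).
    by apply: (std_opD (f := fun w => ad_der u f (g w))); exact: std_op_comp.
  apply/funext => w; rewrite /ad_der (linear_funB (std_op_linear Qf)); lie_ring.
Qed.

Lemma half_ad_derC f u v : linear f -> half_derivation f ->
  ad_der u f v = ad_der v f u.
Proof.
move=> lf hf; apply: subr0_eq; rewrite /ad_der (lieC v u) (linear_funN lf).
transitivity (lie (f u) v + lie u (f v) - f (lie u v) *+ 2); first by lie_ring.
by rewrite hf subrr.
Qed.

Lemma std_op_half f : std_op f -> half_derivation f.
Proof.
elim=> [|x y z|{}f g Qf hf Qg hg|a {}f Qf hf|{}f g Qf hf Qg hg] u v.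
- by rewrite mulr2n.
- by apply: lie_std3_half; [exact: st5_char0|exact: st5_identity].
- exact: half_derivationD.
- by rewrite scalerMnr hf lieZl lieZr scalerDr.
have [lf lg] := (std_op_linear Qf, std_op_linear Qg).
(* A composite of 1/2-derivations need not be one. Here [D u f] commutes with [g], so
   [D u f (g v) = g (D v f u) = D v f (g u)]; doubled and expanded, this is the missing relation
   [[f u, g v] + [g u, f v] = [f (g u), v] + [u, f (g v)]]. *)
have e : ad_der u f (g v) *+ 2 = ad_der v f (g u) *+ 2.
  congr (_ *+ 2); have Df w := ad_der_std_op w Qf.
  rewrite (std_op_comm v (Df u) Qg) (std_op_comm u (Df v) Qg).
  by rewrite half_ad_derC.
move: e; rewrite /ad_der !mulrnBl !hf => e.
apply/subr0_eq/(mulrn_char0 (st5_char0 L) (n := 1)).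
rewrite -(linear_funMn lf) hg (linear_funD lf) mulrnBl mulrnDl !hf.
move/eqP: e; rewrite -subr_eq0 => /eqP e.
by rewrite -[RHS]oppr0 -e; lie_ring.
Qed.
End StandardAlgebra.

Section StandardAlgebraRing.
Variables (k : fieldType) (L : st5_data k).

Definition std_pred : {pred L -> L} := fun f => `[< std_op f >].

Fact std_predP f : reflect (std_op f) (f \in std_pred).
Proof. exact: asboolP. Qed.

Record std_alg := StdAlg { std_fun :> L -> L; _ : std_fun \in std_pred }.

Fact std_algP (f : std_alg) : std_op f.
Proof. by case: f => f Qf; apply/std_predP. Qed.

HB.instance Definition _ := [isSub for std_fun].
HB.instance Definition _ := [Choice of std_alg by <:].

Fact std_pred_submod : submod_closed std_pred.
Proof.
split=> [|c f g /std_predP Qf /std_predP Qg]; apply/std_predP.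
  rewrite (_ : 0 = fun w => 0 *: w); first exact/std_opZ/std_op_id.
  by apply/funext => w; rewrite scale0r.
by apply: (std_opD (f := fun w => c *: f w)) => //; exact: std_opZ.
Qed.
HB.instance Definition _ := GRing.isSubmodClosed.Build k (L -> L) std_pred std_pred_submod.
HB.instance Definition _ := [SubChoice_isSubLmodule of std_alg by <:].

Definition std_of f (Qf : std_op f) : std_alg := StdAlg (introT (std_predP _) Qf).

Definition std_one := std_of (@std_op_id k L).
Definition std_mul (f g : std_alg) := std_of (std_op_comp (std_algP f) (std_algP g)).

Lemma std_alg_eqP (f g : std_alg) : (forall w, f w = g w) -> f = g.
Proof. by move=> e; apply/val_inj/funext. Qed.

Fact std_mulA : associative std_mul.
Proof. by move=> f g h; apply: std_alg_eqP. Qed.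
Fact std_mulC : commutative std_mul.
Proof.
move=> f g; apply: std_alg_eqP => w.
exact: (std_op_comm w (std_algP f) (std_algP g)).
Qed.
Fact std_mul1 : left_id std_one std_mul.
Proof. by move=> f; apply: std_alg_eqP. Qed.
Fact std_mulDl : left_distributive std_mul +%R.
Proof. by move=> f g h; apply: std_alg_eqP. Qed.

HB.instance Definition _ :=
  GRing.Zmodule_isComPzRing.Build std_alg std_mulA std_mulC std_mul1 std_mulDl.

Implicit Types (f g : std_alg) (u v w x y z : L).

Lemma std_funD f g w : (f + g) w = f w + g w. Proof. by []. Qed.
Lemma std_funN f w : (- f) w = - f w. Proof. by []. Qed.
Lemma std_funZ c f w : (c *: f) w = c *: f w. Proof. by []. Qed.
Lemma std_funM f g w : (f * g) w = f (g w). Proof. by []. Qed.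
Lemma std_fun0 w : (0 : std_alg) w = 0. Proof. by []. Qed.
Lemma std_fun_linear f : linear f.
Proof. exact/std_op_linear/std_algP. Qed.

Definition std3 x y z : std_alg := std_of (@std_op_gen k L x y z).
Definition std_der u f : std_alg := std_of (ad_der_std_op u (std_algP f)).

Lemma std_derE u f w : std_der u f w = lie u (f w) - f (lie u w).
Proof. by []. Qed.

Lemma std_scaleAl c f g : c *: (f * g) = (c *: f) * g.
Proof. by apply: std_alg_eqP. Qed.

Lemma std_derC u v f : std_der u f v = std_der v f u.
Proof.
by apply: half_ad_derC; [exact: std_fun_linear | exact/std_op_half/std_algP].
Qed.

(* [std_der u f] maps [v] to the [std_alg]-multiple [std_der v f u] of [u]. *)
Lemma std_der_mulC u v f g : std_der u f * std_der v g = std_der v f * std_der u g.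
Proof.
apply: std_alg_eqP => w; rewrite !std_funM.
rewrite (std_derC v w g) -[LHS]std_funM mulrC std_funM (std_derC u v f).
by rewrite -[LHS]std_funM mulrC std_funM (std_derC w u g).
Qed.

Lemma std_derD u f g : std_der u (f + g) = std_der u f + std_der u g.
Proof.
by apply: std_alg_eqP => w; rewrite std_funD !std_derE !std_funD; lie_ring.
Qed.

Lemma std_derZ u c f : std_der u (c *: f) = c *: std_der u f.
Proof.
apply: std_alg_eqP => w; rewrite std_funZ !std_derE !std_funZ.
by rewrite lieZr scalerBr.
Qed.

Lemma std_der_linear f : linear (std_der^~ f).
Proof.
move=> c u v; apply: std_alg_eqP => w; rewrite std_funD std_funZ !std_derE.
by rewrite !lieDl !lieZl (std_fun_linear f) scalerBr; lie_ring.
Qed.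

Lemma std_der_lie u v f :
  std_der (lie u v) f = std_der u (std_der v f) - std_der v (std_der u f).
Proof.
apply: std_alg_eqP => w; rewrite std_funD std_funN !std_derE.
by rewrite (lie_derl u v w) (linear_funB (std_fun_linear f)); lie_ring.
Qed.

Lemma std3_der u x y z :
  std_der u (std3 x y z) = std3 (lie u x) y z + std3 x (lie u y) z + std3 x y (lie u z).
Proof.
apply: std_alg_eqP => w; rewrite !std_funD std_derE /= /lie_std3; lie_ring.
Qed.

(** This form of St_5 later acts as Cramer's rule: on [std_kernel] it writes [std3 a b c] times
    [ad x] through [ad a], [ad b] and [ad c]. *)
Lemma std3_exchange x y z u v : lie x (std3 y z u v) - lie y (std3 x z u v)
  + lie z (std3 x y u v) - lie u (std3 x y z v) = 0.
Proof. exact: (lie_std4_eq0 (@st5_identity k L)). Qed.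

Lemma lie2_std3 a b c d : lie (lie a b) (lie c d) *+ 2 = std3 a b c d - std3 a b d c.
Proof. by rewrite /= /lie_std3; lie_ring. Qed.

End StandardAlgebraRing.

(** * Quotients of differential algebras, the Wronskian envelope *)

(* A set with operations satisfying the axioms of a differential algebra up to a congruence. *)
Record raw_diff (k : fieldType) (T : Type) := RawDiff {
  raw_eq : T -> T -> Prop;
  raw_zero : T;
  raw_add : T -> T -> T;
  raw_scale : k -> T -> T;
  raw_mul : T -> T -> T;
  raw_der : T -> T;
  raw_refl : forall x, raw_eq x x;
  raw_sym : forall x y, raw_eq x y -> raw_eq y x;
  raw_trans : forall x y z, raw_eq x y -> raw_eq y z -> raw_eq x z;
  raw_add_eq : forall x x' y y',
    raw_eq x x' -> raw_eq y y' -> raw_eq (raw_add x y) (raw_add x' y');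
  raw_scale_eq : forall c x x', raw_eq x x' -> raw_eq (raw_scale c x) (raw_scale c x');
  raw_mul_eq : forall x x' y y',
    raw_eq x x' -> raw_eq y y' -> raw_eq (raw_mul x y) (raw_mul x' y');
  raw_der_eq : forall x x', raw_eq x x' -> raw_eq (raw_der x) (raw_der x');
  raw_addA : forall x y z,
    raw_eq (raw_add x (raw_add y z)) (raw_add (raw_add x y) z);
  raw_addC : forall x y, raw_eq (raw_add x y) (raw_add y x);
  raw_add0 : forall x, raw_eq (raw_add raw_zero x) x;
  raw_addN : forall x, raw_eq (raw_add (raw_scale (-1) x) x) raw_zero;
  raw_scaleA : forall a b x,
    raw_eq (raw_scale a (raw_scale b x)) (raw_scale (a * b) x);
  raw_scale1 : forall x, raw_eq (raw_scale 1 x) x;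
  raw_scaleDr : forall a x y,
    raw_eq (raw_scale a (raw_add x y)) (raw_add (raw_scale a x) (raw_scale a y));
  raw_scaleDl : forall a b x,
    raw_eq (raw_scale (a + b) x) (raw_add (raw_scale a x) (raw_scale b x));
  raw_mulC : forall x y, raw_eq (raw_mul x y) (raw_mul y x);
  raw_mulA : forall x y z,
    raw_eq (raw_mul x (raw_mul y z)) (raw_mul (raw_mul x y) z);
  raw_mulDl : forall x y z,
    raw_eq (raw_mul (raw_add x y) z) (raw_add (raw_mul x z) (raw_mul y z));
  raw_mulZl : forall a x y,
    raw_eq (raw_mul (raw_scale a x) y) (raw_scale a (raw_mul x y));
  raw_derD : forall x y,
    raw_eq (raw_der (raw_add x y)) (raw_add (raw_der x) (raw_der y));
  raw_derZ : forall a x, raw_eq (raw_der (raw_scale a x)) (raw_scale a (raw_der x));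
  raw_derM : forall x y,
    raw_eq (raw_der (raw_mul x y)) (raw_add (raw_mul (raw_der x) y) (raw_mul x (raw_der y)))
}.

Section RawQuotient.
Variables (k : fieldType) (T : Type) (R : raw_diff k T).

(** Elements are equivalence classes taken as sets, so congruent terms give equal elements by
    extensionality. *)
Definition raw_quot : Type := {C : set T | exists x, C = raw_eq R x}.

HB.instance Definition _ := gen_eqMixin raw_quot.
HB.instance Definition _ := gen_choiceMixin raw_quot.

Definition raw_pi (x : T) : raw_quot := exist _ (raw_eq R x) (ex_intro _ x erefl).
Definition raw_repr (q : raw_quot) : T := sval (cid (svalP q)).

Lemma raw_reprK q : raw_pi (raw_repr q) = q.
Proof.
case: q => C HC; rewrite /raw_pi /raw_repr; apply: eq_exist => /=.
by case: (cid _) => x /= ->.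
Qed.

Lemma raw_piP x y : raw_pi x = raw_pi y <-> raw_eq R x y.
Proof.
split=> [[->]|exy]; first exact: raw_refl.
apply: eq_exist; apply/seteqP; split=> z; apply: raw_trans => //.
exact: raw_sym.
Qed.

Lemma raw_repr_pi x : raw_eq R (raw_repr (raw_pi x)) x.
Proof. by apply/raw_piP; rewrite raw_reprK. Qed.

Definition rq_add p q := raw_pi (raw_add R (raw_repr p) (raw_repr q)).
Definition rq_scale a q := raw_pi (raw_scale R a (raw_repr q)).
Definition rq_mul p q := raw_pi (raw_mul R (raw_repr p) (raw_repr q)).
Definition rq_der q := raw_pi (raw_der R (raw_repr q)).

Lemma raw_pi_add x y : raw_pi (raw_add R x y) = rq_add (raw_pi x) (raw_pi y).
Proof. by apply/raw_piP/raw_add_eq; apply/raw_sym/raw_repr_pi. Qed.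
Lemma raw_pi_scale a x : raw_pi (raw_scale R a x) = rq_scale a (raw_pi x).
Proof. by apply/raw_piP/raw_scale_eq; apply/raw_sym/raw_repr_pi. Qed.
Lemma raw_pi_mul x y : raw_pi (raw_mul R x y) = rq_mul (raw_pi x) (raw_pi y).
Proof. by apply/raw_piP/raw_mul_eq; apply/raw_sym/raw_repr_pi. Qed.
Lemma raw_pi_der x : raw_pi (raw_der R x) = rq_der (raw_pi x).
Proof. by apply/raw_piP/raw_der_eq; apply/raw_sym/raw_repr_pi. Qed.

Lemma raw_quot_ind (P : raw_quot -> Prop) : (forall x, P (raw_pi x)) -> forall q, P q.
Proof. by move=> Ppi q; rewrite -(raw_reprK q). Qed.

Local Ltac lift_raw lem :=
  do ?[hnf; elim/raw_quot_ind => ?];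
  rewrite -?(raw_pi_add, raw_pi_scale, raw_pi_mul, raw_pi_der); by apply/raw_piP; apply lem.

Fact rq_addA : associative rq_add. Proof. lift_raw raw_addA. Qed.
Fact rq_addC : commutative rq_add. Proof. lift_raw raw_addC. Qed.
Fact rq_add0 : left_id (raw_pi (raw_zero R)) rq_add. Proof. lift_raw raw_add0. Qed.
Fact rq_addN : left_inverse (raw_pi (raw_zero R)) (rq_scale (-1)) rq_add.
Proof. lift_raw raw_addN. Qed.

HB.instance Definition _ :=
  GRing.isZmodule.Build raw_quot rq_addA rq_addC rq_add0 rq_addN.

Lemma raw_piD x y : raw_pi (raw_add R x y) = raw_pi x + raw_pi y.
Proof. exact: raw_pi_add. Qed.

Local Ltac lift_lin lem :=
  do ?[hnf; elim/raw_quot_ind => ?];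
  rewrite -?(raw_piD, raw_pi_scale, raw_pi_mul, raw_pi_der);
  by apply/raw_piP; apply lem.

Fact rq_scaleA a b q : rq_scale a (rq_scale b q) = rq_scale (a * b) q.
Proof. move: q; lift_raw raw_scaleA. Qed.
Fact rq_scale1 : left_id 1 rq_scale. Proof. lift_raw raw_scale1. Qed.
Fact rq_scaleDr : right_distributive rq_scale +%R.
Proof. move=> a; lift_lin raw_scaleDr. Qed.
Fact rq_scaleDl q : {morph rq_scale^~ q : a b / a + b}.
Proof. move=> a b; move: q; lift_lin raw_scaleDl. Qed.

HB.instance Definition _ := GRing.Zmodule_isLmodule.Build k raw_quot
  rq_scaleA rq_scale1 rq_scaleDr rq_scaleDl.

Lemma raw_piZ a x : raw_pi (raw_scale R a x) = a *: raw_pi x.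
Proof. exact: raw_pi_scale. Qed.

Fact rq_mulC : commutative rq_mul. Proof. lift_raw raw_mulC. Qed.
Fact rq_mulA : associative rq_mul. Proof. lift_raw raw_mulA. Qed.
Fact rq_mulDl p q r : rq_mul (p + q) r = rq_mul p r + rq_mul q r.
Proof. move: p q r; lift_lin raw_mulDl. Qed.
Fact rq_mulZl a p q : rq_mul (a *: p) q = a *: rq_mul p q.
Proof.
move: p q; do 2!elim/raw_quot_ind => ?.
by rewrite -raw_piZ -!raw_pi_mul -raw_piZ; apply/raw_piP/raw_mulZl.
Qed.
Fact rq_mul_linear q : linear (rq_mul^~ q).
Proof. by move=> a p r; rewrite rq_mulDl rq_mulZl. Qed.
Fact rq_derD p q : rq_der (p + q) = rq_der p + rq_der q.
Proof. move: p q; lift_lin raw_derD. Qed.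
Fact rq_derZ a q : rq_der (a *: q) = a *: rq_der q.
Proof.
move: q; elim/raw_quot_ind => ?.
by rewrite -raw_piZ -!raw_pi_der -raw_piZ; apply/raw_piP/raw_derZ.
Qed.
Fact rq_der_linear : linear rq_der.
Proof. by move=> a p r; rewrite rq_derD rq_derZ. Qed.
Fact rq_derM p q : rq_der (rq_mul p q) = rq_mul (rq_der p) q + rq_mul p (rq_der q).
Proof. move: p q; lift_lin raw_derM. Qed.

HB.instance Definition _ := isDiffAlgebra.Build k raw_quot
  rq_mulC rq_mulA rq_mul_linear rq_der_linear rq_derM.

Lemma raw_piM x y : raw_pi (raw_mul R x y) = dmul (raw_pi x) (raw_pi y).
Proof. exact: raw_pi_mul. Qed.
Lemma raw_pi_d x : raw_pi (raw_der R x) = der (raw_pi x).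
Proof. exact: raw_pi_der. Qed.
Lemma raw_pi0 : raw_pi (raw_zero R) = 0. Proof. by []. Qed.

End RawQuotient.

Section DiffAlgBasics.
Variables (k : fieldType) (A : diffAlgType k).
Implicit Types a b c : A.

Lemma dmulDl a b c : dmul (a + b) c = dmul a c + dmul b c.
Proof. exact: (linear_funD (dmul_linear_l c)). Qed.
Lemma dmulDr a b c : dmul c (a + b) = dmul c a + dmul c b.
Proof. by rewrite !(dmulC c) dmulDl. Qed.
Lemma dmulZl x a c : dmul (x *: a) c = x *: dmul a c.
Proof. exact: (linear_funZ (dmul_linear_l c)). Qed.
Lemma dmulZr x a c : dmul c (x *: a) = x *: dmul c a.
Proof. by rewrite !(dmulC c) dmulZl. Qed.
Lemma dmulNl a c : dmul (- a) c = - dmul a c.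
Proof. exact: (linear_funN (dmul_linear_l c)). Qed.
Lemma dmulNr a c : dmul c (- a) = - dmul c a.
Proof. by rewrite !(dmulC c) dmulNl. Qed.
Lemma dmul0l c : dmul 0 c = 0 :> A.
Proof. exact: (linear_fun0 (dmul_linear_l c)). Qed.
Lemma dmul0r c : dmul c 0 = 0 :> A. Proof. by rewrite dmulC dmul0l. Qed.
Lemma derD a b : der (a + b) = der a + der b. Proof. exact: (linear_funD der_linear). Qed.
Lemma derZ x a : der (x *: a) = x *: der a. Proof. exact: (linear_funZ der_linear). Qed.
Lemma derN a : der (- a) = - der a. Proof. exact: (linear_funN der_linear). Qed.
Lemma der0 : der 0 = 0 :> A. Proof. exact: (linear_fun0 der_linear). Qed.
Lemma diff_lieE (a b : Diff A) :
  lie a b = dmul (a : A) (der (b : A)) - dmul (der (a : A)) (b : A).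
Proof. by []. Qed.
End DiffAlgBasics.

Section PackLinear.
Variables (k : fieldType) (U V : lmodType k) (f : U -> V) (lf : linear f).
(* The vacuous [let] makes the constant depend on [lf], so that its instance is inferred. *)
Definition fun_linear_fun := let _ := lf in f.
HB.instance Definition _ := GRing.isLinear.Build k U V *:%R fun_linear_fun lf.
Definition fun_linear : {linear U -> V} := fun_linear_fun.
Lemma fun_linearE : fun_linear =1 f. Proof. by []. Qed.
End PackLinear.

Section WronskianEnvelope.
Variables (k : fieldType) (L : lieAlgType k).

Inductive wterm :=
  | WVar of L
  | WZero
  | WAdd of wterm & wterm
  | WScale of k & wterm
  | WMul of wterm & wterm
  | WDer of wterm.

Fixpoint weval (A : diffAlgType k) (f : L -> A) (t : wterm) : A :=
  match t with
  | WVar x => f x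
  | WZero => 0
  | WAdd t1 t2 => weval f t1 + weval f t2
  | WScale c t1 => c *: weval f t1
  | WMul t1 t2 => dmul (weval f t1) (weval f t2)
  | WDer t1 => der (weval f t1)
  end.

(** Terms are identified when all Lie homomorphisms evaluate them equally. The axioms then hold
    because they hold after evaluation, and every homomorphism factors by construction. *)
Definition weq (s t : wterm) : Prop :=
  forall (A : diffAlgType k) (f : {linear L -> Diff A}), lie_morphism f ->
    weval (f : L -> A) s = weval (f : L -> A) t.

Definition wraw : raw_diff k wterm.
Proof.
refine (@RawDiff k wterm weq WZero WAdd WScale WMul WDer
  _ _ _ _ _ _ _ _ _ _ _ _ _ _ _ _ _ _ _ _ _ _).
- by move=> t A f.
- by move=> s t e A f mf; rewrite e.
- by move=> s t u e e' A f mf; rewrite e ?e'.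
- by move=> s s' t t' e e' A f mf /=; rewrite e ?e'.
- by move=> c s s' e A f mf /=; rewrite e.
- by move=> s s' t t' e e' A f mf /=; rewrite e ?e'.
- by move=> s s' e A f mf /=; rewrite e.
- by move=> s t u A f mf /=; rewrite addrA.
- by move=> s t A f mf /=; rewrite addrC.
- by move=> s A f mf /=; rewrite add0r.
- by move=> s A f mf /=; rewrite scaleN1r addNr.
- by move=> a b s A f mf /=; rewrite scalerA.
- by move=> s A f mf /=; rewrite scale1r.
- by move=> a s t A f mf /=; rewrite scalerDr.
- by move=> a b s A f mf /=; rewrite scalerDl.
- by move=> s t A f mf /=; rewrite dmulC.
- by move=> s t u A f mf /=; rewrite dmulA.
- by move=> s t u A f mf /=; rewrite dmulDl.
- by move=> a s t A f mf /=; rewrite dmulZl.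
- by move=> s t A f mf /=; rewrite derD.
- by move=> a s A f mf /=; rewrite derZ.
- by move=> s t A f mf /=; rewrite der_dmul.
Defined.

Definition wenvelope := raw_quot wraw.

Definition wvar (x : L) : Diff wenvelope := raw_pi wraw (WVar x).

Fact wvar_linear : linear wvar.
Proof.
move=> c x y; rewrite /wvar -[RHS]/(c *: raw_pi wraw _ + raw_pi wraw _ : wenvelope).
by rewrite -raw_piZ -raw_piD; apply/raw_piP => A f mf /=; rewrite linearP.
Qed.

Definition wiota : {linear L -> Diff wenvelope} := fun_linear wvar_linear.

Lemma wiota_morphism : lie_morphism wiota.
Proof.
move=> x y; rewrite diff_lieE /= -scaleN1r /wiota !fun_linearE /wvar.
rewrite -!raw_pi_d -!raw_piM -raw_piZ -raw_piD; apply/raw_piP => A f mf /=.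
by rewrite scaleN1r mf.
Qed.

Lemma wenvelopeP : wronskian_envelope wiota.
Proof.
split=> [|A f mf]; first exact: wiota_morphism.
pose g (q : wenvelope) : A := weval (f : L -> A) (raw_repr q).
have gE t : g (raw_pi wraw t) = weval (f : L -> A) t by exact: (raw_repr_pi wraw t).
have lg : linear g.
  move=> c; elim/raw_quot_ind => s; elim/raw_quot_ind => t.
  by rewrite -raw_piZ -raw_piD !gE.
exists (fun_linear lg); split=> [|x|h [hM hd] hf].
- split; first by elim/raw_quot_ind => s; elim/raw_quot_ind => t; rewrite -raw_piM !fun_linearE !gE.
  by elim/raw_quot_ind => s; rewrite -raw_pi_d !fun_linearE !gE.
- exact: gE.
elim/raw_quot_ind => t; rewrite fun_linearE gE.
elim: t => [x||s IHs t IHt|c t IHt|s IHs t IHt|t IHt] /=.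
- exact: hf.
- by rewrite raw_pi0 linear0.
- by rewrite raw_piD linearD IHs IHt.
- by rewrite raw_piZ linearZ IHt.
- by rewrite raw_piM hM IHs IHt.
- by rewrite raw_pi_d hd IHt.
Qed.

(** Equality in the envelope is equality under all homomorphisms, so it suffices that these separate
    points. *)
Lemma wiota_inj : (forall x : L, x <> 0 ->
    exists (A : diffAlgType k) (f : {linear L -> Diff A}), lie_morphism f /\ f x <> 0) ->
  injective wiota.
Proof.
move=> sep x y exy; apply: subr0_eq; apply: contrapT => /sep[A [f [mf]]]; apply.
apply/eqP; rewrite linearB subr_eq0; apply/eqP.
by have /raw_piP/(_ A f mf) := exy.
Qed.

End WronskianEnvelope.

(** * Quotients by differential ideals and semiprimeness *)

Section SemiprimeQuotient.
Variables (k : fieldType) (A : diffAlgType k) (N : set A).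
Hypothesis idN : diff_ideal N.

Let sN : subspace N. Proof. by case: idN. Qed.
Let mN a b : N b -> N (dmul a b). Proof. by case: idN => _ + _; apply. Qed.
Let dN a : N a -> N (der a). Proof. by case: idN => _ _; apply. Qed.

Let N_eq a b : a = b -> N (a - b).
Proof. by move=> ->; rewrite subrr; apply: subspace0. Qed.

Definition ideal_raw : raw_diff k A.
Proof.
refine (@RawDiff k A (fun a b => N (a - b)) 0 +%R *:%R dmul der
  _ _ _ _ _ _ _ _ _ _ _ _ _ _ _ _ _ _ _ _ _ _).
- by move=> a; rewrite subrr; apply: subspace0.
- by move=> a b Nab; rewrite -opprB; apply: subspaceN.
- by move=> a b c Nab Nbc; rewrite -(subrKA b); apply: subspaceD.
- by move=> a a' b b' Na Nb; rewrite opprD addrACA; apply: subspaceD.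
- by move=> c a a' Na; rewrite -scalerBr; apply: subspaceZ.
- move=> a a' b b' Na Nb; have -> : dmul a b - dmul a' b' = dmul a (b - b') + dmul (a - a') b'.
    by rewrite dmulDr dmulDl dmulNr dmulNl subrKA.
  by apply: subspaceD => //; [apply: mN | rewrite dmulC; apply: mN].
- by move=> a a' Na; rewrite -derN -derD; apply: dN.
- by move=> a b c; apply: N_eq; rewrite addrA.
- by move=> a b; apply: N_eq; rewrite addrC.
- by move=> a; apply: N_eq; rewrite add0r.
- by move=> a; apply: N_eq; rewrite scaleN1r addNr.
- by move=> a b c; apply: N_eq; rewrite scalerA.
- by move=> a; apply: N_eq; rewrite scale1r.
- by move=> a b c; apply: N_eq; rewrite scalerDr.
- by move=> a b c; apply: N_eq; rewrite scalerDl.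
- by move=> a b; apply: N_eq; rewrite dmulC.
- by move=> a b c; apply: N_eq; rewrite dmulA.
- by move=> a b c; apply: N_eq; rewrite dmulDl.
- by move=> a b c; apply: N_eq; rewrite dmulZl.
- by move=> a b; apply: N_eq; rewrite derD.
- by move=> a b; apply: N_eq; rewrite derZ.
- by move=> a b; apply: N_eq; rewrite der_dmul.
Defined.

Definition diff_quot := raw_quot ideal_raw.
Definition dq_pi (a : A) : diff_quot := raw_pi ideal_raw a.

Fact dq_pi_linear : linear dq_pi.
Proof. by move=> c a b; rewrite /dq_pi -raw_piZ -raw_piD. Qed.

Lemma dq_pi_eq0 a : dq_pi a = 0 <-> N a.
Proof.
rewrite /dq_pi -(raw_pi0 ideal_raw); split=> [/raw_piP | Na].
  by rewrite /raw_eq /= subr0.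
by apply/raw_piP; rewrite /raw_eq /= subr0.
Qed.

End SemiprimeQuotient.

Lemma mem_span_op (k : fieldType) (V : lmodType k) (op : V -> V -> V) (I J : set V) x y :
  I x -> J y -> span_op op I J (op x y).
Proof. by move=> Ix Jy S [_]; apply; exists x => //; exists y. Qed.

Section SemiprimeEmbedding.
Variables (k : fieldType) (L : lieAlgType k) (A : diffAlgType k) (f : {linear L -> Diff A}).
Hypotheses (semiprimeL : lie_semiprime L) (mf : lie_morphism f) (injf : injective f).

(** These are the differential ideals modulo which [f] stays injective. *)
Let avoids (I : set A) := diff_ideal I /\ forall x : L, I (f x) -> x = 0.

Lemma maximal_avoiding_ideal :
  exists2 N, avoids N & forall I, avoids I -> N `<=` I -> I = N.
Proof.
pose P (I : set A) := I = set0 \/ avoids I.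
have [|N [PN maxN]] := @Zorn_bigcup A P.
  move=> F FP totF; have [->|/set0P[a [I FI Ia]]] := eqVneq (\bigcup_(I in F) I) set0.
    by left.
  have PF J b : F J -> J b -> avoids J.
    by move=> FJ Jb; have [J0|//] := FP _ FJ; rewrite J0 in Jb.
  right; split; last by move=> x [J FJ Jx]; apply: (PF _ _ FJ Jx).2.
  split; first split.
  - by exists I => //; apply: subspace0; case: (PF _ _ FI Ia) => -[].
  - move=> c u v [J FJ Ju] [K FK Kv].
    have [] := totF _ _ FJ FK => sJK.
      by exists K => //; case: (PF _ _ FK Kv) => -[[_ D] _ _] _; apply: D => //; apply: sJK.
    by exists J => //; case: (PF _ _ FJ Ju) => -[[_ D] _ _] _; apply: D => //; apply: sJK.
  - by move=> b c [J FJ Jc]; exists J => //; case: (PF _ _ FJ Jc) => -[_ M _] _; apply: M.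
  - by move=> c [J FJ Jc]; exists J => //; case: (PF _ _ FJ Jc) => -[_ _ D] _; apply: D.
have av0 : avoids [set 0].
  split; last by move=> x /= fx0; apply: injf; rewrite fx0 linear0.
  split; [split=> // c u v -> -> | move=> a b -> | move=> a ->] => /=.
  - by rewrite scaler0 addr0.
  - by rewrite dmul0r.
  - by rewrite der0.
have avN : avoids N.
  have [N0|//] := PN; have := maxN [set 0]; rewrite N0.
  by case; [split => // /(_ 0 erefl) | right].
exists N => // I avI sNI; apply: contrapT => neq; apply: (maxN I); last by right.
by split=> // sIN; apply: neq; apply/seteqP.
Qed.

(** Let [I] be a differential ideal of square zero in the quotient by a maximal [N], and [M] its
    preimage. The elements that [f] sends into [M] form an abelian ideal of [L], which vanishes; so
    [M] avoids [L], and [M = N] by maximality. *)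
Lemma semiprime_embedding : exists (B : diffAlgType k) (g : {linear L -> Diff B}),
  [/\ diff_semiprime B, lie_morphism g & injective g].
Proof.
have [N [idN avN] maxN] := maximal_avoiding_ideal.
pose B : diffAlgType k := diff_quot idN.
pose pi : A -> B := dq_pi idN.
have lpi : linear pi := dq_pi_linear idN.
have lg : linear (fun x => pi (f x) : Diff B).
  by move=> c x y; rewrite linearP; apply: lpi.
have piM a b : pi (dmul a b) = dmul (pi a) (pi b) by apply: raw_piM.
have pid a : pi (der a) = der (pi a) by apply: raw_pi_d.
exists B, (fun_linear lg); split.
- move=> I idI I0 II0.
  have [sI mI dI] := idI.
  pose M a := I (pi a).
  have idM : diff_ideal M.
    split; first split.
    - by rewrite /M (linear_fun0 lpi); apply: subspace0.
    - by move=> c u v Mu Mv; rewrite /M lpi; apply: sI.2.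
    - by move=> a b Mb; rewrite /M piM; apply: mI.
    - by move=> a Ma; rewrite /M pid; apply: dI.
  have sNM : N `<=` M.
    by move=> a /(dq_pi_eq0 idN) a0; rewrite /M /pi a0; apply: subspace0.
  pose J := [set x : L | M (f x)].
  have iJ : lie_ideal J.
    split; first split.
    - by rewrite /J /= linear0; case: idM => -[].
    - by move=> c u v; rewrite /J /= linearP; case: idM => -[_ + _ _]; apply.
    - move=> x y Jy; rewrite /J /= mf diff_lieE; have [sM mM dM] := idM.
      by apply: subspaceB => //; apply: mM => //; apply: dM.
  have J0 : forall x, J x -> x = 0.
    apply: (abelian_ideal_eq0 semiprimeL iJ) => x y Jx Jy; apply: avN.
    apply/(dq_pi_eq0 idN); rewrite -/(pi _) mf diff_lieE (linear_funB lpi) !piM !pid.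
    have z a b : I a -> I b -> dmul a b = 0.
      by move=> Ia Ib; have := mem_span_op (op := dmul) Ia Ib; rewrite II0.
    by rewrite !z ?subrr //; apply: dI.
  apply: I0; apply/seteqP; split=> [q Iq|_ ->]; last exact: subspace0.
  rewrite -(raw_reprK q) /=; apply/(dq_pi_eq0 idN).
  have NM : M `<=` N by rewrite (maxN M).
  by apply: NM; rewrite /M /pi /dq_pi raw_reprK.
- move=> x y; rewrite !fun_linearE mf !diff_lieE (linear_funB lpi) !piM !pid.
  by [].
move=> x y /= exy; apply: subr0_eq; apply: avN; apply/(dq_pi_eq0 idN).
rewrite -/(pi _) linearB (linear_funB lpi); apply/eqP; rewrite subr_eq0; apply/eqP.
exact: exy.
Qed.

End SemiprimeEmbedding.

(** * Taylor expansion along a vector field *)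

(* Sequences of Hurwitz series: [a m n] is the n-th Taylor derivative of the m-th series. *)
Definition hurwitz (k : fieldType) (R : diffAlgType k) : Type := nat -> nat -> R.

Section Hurwitz.
Variables (k : fieldType) (R : diffAlgType k).
Implicit Types a b c : nat -> R.

(** The n-th derivative of a product, by iterating the Leibniz rule; in these coordinates the
    derivation is the shift. *)
Fixpoint hmul n a b : R :=
  match n with
  | 0 => dmul (a 0%N) (b 0%N)
  | n'.+1 => hmul n' (fun i => a i.+1) b + hmul n' a (fun i => b i.+1)
  end.

Lemma hmulC n a b : hmul n a b = hmul n b a.
Proof.
elim: n a b => [|n IHn] a b /=; first exact: dmulC.
by rewrite addrC; congr (_ + _); exact: IHn.
Qed.

Lemma hmul_linear n b : linear (hmul n ^~ b).
Proof.
move=> x; elim: n b => [|n IHn] b a c /=; first exact: dmul_linear_l.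
rewrite (IHn b (fun i => a i.+1) (fun i => c i.+1)) (IHn _ a c).
by rewrite scalerDr addrACA.
Qed.

Lemma hmulDl n a b c : hmul n (a + b) c = hmul n a c + hmul n b c.
Proof. exact: (linear_funD (hmul_linear n c)). Qed.

Lemma hmulA n a b c :
  hmul n a (fun i => hmul i b c) = hmul n (fun i => hmul i a b) c.
Proof.
elim: n a b c => [|n IHn] a b c /=; first exact: dmulA.
have E (f g : nat -> R) : (fun i => f i + g i) = f + g by [].
by rewrite !E hmulDl (hmulC _ a) hmulDl !(hmulC _ _ a) !IHn addrA.
Qed.

HB.instance Definition _ := GRing.Lmodule.copy (hurwitz R) (nat -> nat -> R).

Definition hurwitz_mul (a b : hurwitz R) : hurwitz R := fun m n => hmul n (a m) (b m).
Definition hurwitz_der (a : hurwitz R) : hurwitz R := fun m n => a m n.+1.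

Fact hurwitz_mulC : commutative hurwitz_mul.
Proof. by move=> a b; apply/funext => m; apply/funext => n; apply: hmulC. Qed.
Fact hurwitz_mulA : associative hurwitz_mul.
Proof. by move=> a b c; apply/funext => m; apply/funext => n; apply: hmulA. Qed.
Fact hurwitz_mul_linear (b : hurwitz R) : linear (hurwitz_mul^~ b).
Proof. by move=> x a c; apply/funext => m; apply/funext => n; apply: hmul_linear. Qed.
Fact hurwitz_der_linear : linear hurwitz_der.
Proof. by []. Qed.
Fact hurwitz_derM (a b : hurwitz R) : hurwitz_der (hurwitz_mul a b) =
  hurwitz_mul (hurwitz_der a) b + hurwitz_mul a (hurwitz_der b).
Proof. by []. Qed.

HB.instance Definition _ := isDiffAlgebra.Build k (hurwitz R)
  hurwitz_mulC hurwitz_mulA hurwitz_mul_linear hurwitz_der_linear hurwitz_derM.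

End Hurwitz.

(* The pair [(a, m)] stands for [U^-m a]. *)
Section Localization.
Variables (k : fieldType) (A : diffAlgType k) (U : A -> A).
Hypotheses (U_linear : linear U) (U_mul : forall a b, U (dmul a b) = dmul (U a) b)
  (U_der : forall a, U (der a) = der (U a)).
Implicit Types (a b : A) (p q r : A * nat) (n : nat).

Let UD n a b : iter n U (a + b) = iter n U a + iter n U b.
Proof. by elim: n => //= n ->; rewrite (linear_funD U_linear). Qed.
Let UZ n c a : iter n U (c *: a) = c *: iter n U a.
Proof. by elim: n => //= n ->; rewrite (linear_funZ U_linear). Qed.
Let U0 n : iter n U 0 = 0.
Proof. by elim: n => //= n ->; rewrite (linear_fun0 U_linear). Qed.
Let UMl n a b : iter n U (dmul a b) = dmul (iter n U a) b.
Proof. by elim: n => //= n ->; rewrite U_mul. Qed.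
Let UMr n a b : iter n U (dmul a b) = dmul a (iter n U b).
Proof. by rewrite dmulC UMl dmulC. Qed.
Let UM2 m n a b : iter (m + n) U (dmul a b) = dmul (iter m U a) (iter n U b).
Proof. by rewrite iterD UMr UMl. Qed.
Let Ud n a : iter n U (der a) = der (iter n U a).
Proof. by elim: n => //= n ->; rewrite U_der. Qed.
Let Ucat m n a : iter m U (iter n U a) = iter (m + n) U a.
Proof. by rewrite iterD. Qed.

Let Uadd i a b m n l : iter m U a = iter n U b -> (l = i + m)%N ->
  iter l U a = iter (i + n) U b.
Proof. by move=> e ->; rewrite -!Ucat e. Qed.

(** The extra power [n] makes the relation transitive although [U] may fail to be injective. *)
Definition loc_eq p q := exists n, iter (n + q.2) U p.1 = iter (n + p.2) U q.1.

Definition loc_raw : raw_diff k (A * nat).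
Proof.
refine (@RawDiff k (A * nat) loc_eq (0, 0%N)
  (fun p q => (iter q.2 U p.1 + iter p.2 U q.1, (p.2 + q.2)%N))
  (fun c p => (c *: p.1, p.2))
  (fun p q => (dmul p.1 q.1, (p.2 + q.2)%N))
  (fun p => (der p.1, p.2))
  _ _ _ _ _ _ _ _ _ _ _ _ _ _ _ _ _ _ _ _ _ _).
- by move=> p; exists 0%N.
- by move=> p q [n e]; exists n.
- move=> [a i] [b j] [c l] [m /= e] [n /= e']; exists (m + n + j)%N => /=.
  rewrite (Uadd (i := (n + l)%N) e); last lia; rewrite (Uadd (i := (m + i)%N) e'); last lia.
  by congr iter; lia.
- move=> [a i] [a' i'] [b j] [b' j'] [m /= e] [n /= e']; exists (m + n)%N => /=.
  rewrite !UD !Ucat (Uadd (i := (n + j' + j)%N) e); last lia.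
  rewrite (Uadd (i := (m + i' + i)%N) e'); last lia.
  by congr (iter _ _ _ + iter _ _ _); lia.
- by move=> c [a i] [a' i'] [m /= e]; exists m; rewrite !UZ e.
- move=> [a i] [a' i'] [b j] [b' j'] [m /= e] [n /= e']; exists (m + n)%N => /=.
  rewrite (_ : m + n + (i' + j') = (m + i') + (n + j'))%N; last lia.
  rewrite (_ : m + n + (i + j) = (m + i) + (n + j))%N; last lia.
  by rewrite !UM2 e e'.
- by move=> [a i] [a' i'] [m /= e]; exists m; rewrite !Ud e.
- move=> [a i] [b j] [c l]; exists 0%N => /=; rewrite !UD !Ucat addrA.
  by congr (iter _ _ _ + iter _ _ _ + iter _ _ _); lia.
- move=> [a i] [b j]; exists 0%N => /=; rewrite !UD !Ucat addrC.
  by congr (iter _ _ _ + iter _ _ _); lia.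
- by move=> [a i]; exists 0%N => /=; rewrite U0 add0r.
- by move=> [a i]; exists 0%N => /=; rewrite UZ scaleN1r addNr !U0.
- by move=> c d [a i]; exists 0%N; rewrite /= scalerA.
- by move=> [a i]; exists 0%N; rewrite /= scale1r.
- by move=> c [a i] [b j]; exists 0%N; rewrite /= scalerDr !UZ.
- move=> c d [a i]; exists 0%N; rewrite /= scalerDl !UD !UZ !Ucat.
  by congr (_ *: iter _ _ _ + _ *: iter _ _ _); lia.
- by move=> [a i] [b j]; exists 0%N; rewrite /= dmulC (addnC i j).
- by move=> [a i] [b j] [c l]; exists 0%N; rewrite /= dmulA (addnA i j l).
- move=> [a i] [b j] [c l]; exists 0%N; rewrite /= dmulDl !UD -!UMl !Ucat.
  by congr (iter _ _ _ + iter _ _ _); lia.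
- by move=> c [a i] [b j]; exists 0%N; rewrite /= dmulZl.
- by move=> [a i] [b j]; exists 0%N; rewrite /= derD !Ud.
- by move=> c [a i]; exists 0%N; rewrite /= derZ.
- move=> [a i] [b j]; exists 0%N; rewrite /= der_dmul !UD !Ucat.
  by congr (iter _ _ _ + iter _ _ _); lia.
Defined.

Lemma loc_pi_eq0 a m : raw_pi loc_raw (a, m) = 0 -> exists n, iter n U a = 0.
Proof.
rewrite -(raw_pi0 loc_raw) => /raw_piP[n /= e]; exists n.
by rewrite -(addn0 n) e U0.
Qed.

End Localization.

Section Taylor.
Variables (k : fieldType) (L : lieAlgType k) (R : diffAlgType k).
Variables (j : nat -> L -> R) (u : nat -> L).
Hypotheses (j_linear : forall m, linear (j m))
  (j_lie : forall m x y z, dmul (j m x) (j m (lie y z)) + dmul (j m y) (j m (lie z x))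
     + dmul (j m z) (j m (lie x y)) = 0).
Local Notation H := (hurwitz R).

Let U (a : H) : H := fun m n => dmul (j m (u m)) (a m n).

Let U_linear : linear U.
Proof.
move=> c a b; apply/funext => m; apply/funext => n; rewrite /U.
by rewrite -[LHS]/(dmul _ (c *: a m n + b m n)) dmulDr dmulZr.
Qed.

Let hmulZdmul n c (a b : nat -> R) : dmul c (hmul n a b) = hmul n (fun i => dmul c (a i)) b.
Proof. by elim: n a b => [|n IHn] a b /=; rewrite ?dmulA // dmulDr !IHn. Qed.

Let U_mul a b : U (dmul a b) = dmul (U a) b.
Proof. by apply/funext => m; apply/funext => n; apply: hmulZdmul. Qed.

Let U_der a : U (der a) = der (U a). Proof. by []. Qed.

Let g (v : L) : H := fun m n => j m (iter n (lie (u m)) v).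

Let g_linear : linear g.
Proof.
move=> c v w; apply/funext => m; apply/funext => n.
rewrite -[RHS]/(c *: j m _ + j m _) -j_linear; congr j.
by elim: n => //= n ->; rewrite lieDr lieZr.
Qed.

(** The constant term is [j_lie] at [v], [u], [w]. The induction differentiates in t: both sides
    then become the sum of their values at [[u, v]], [w] and at [v], [[u, w]]. *)
Let g_lie v w : dmul (g v) (der (g w)) - dmul (der (g v)) (g w) = U (g (lie v w)).
Proof.
apply/funext => m; apply/funext => n.
have dg v' : (fun i => g v' m i.+1) = g (lie (u m) v') m.
  by apply/funext => i; rewrite /g iterSr.
suff e v' w' : hmul n (g v' m) (g (lie (u m) w') m)
    - hmul n (g (lie (u m) v') m) (g w' m) = dmul (j m (u m)) (g (lie v' w') m n).
  by rewrite -[RHS]e -!dg.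
elim: n v' w' => [|n IHn] v' w' /=.
  rewrite /g /=; have /eqP := j_lie m v' (u m) w'.
  rewrite -addrA addr_eq0 => /eqP ->; rewrite opprD (dmulC _ (j m w')).
  rewrite (lieC w' v') (linear_funN (j_linear m)) dmulNr opprK.
  by rewrite (lieC v' (u m)) (linear_funN (j_linear m)) dmulNr opprK addrK.
rewrite !dg opprD addrACA !IHn -dmulDr -(linear_funD (j_linear m)).
rewrite /g iterSr; congr (dmul _ (j m _)).
have -> : lie (u m) (lie v' w') = lie (lie (u m) v') w' + lie v' (lie (u m) w').
  by lie_ring.
by elim: (n) => //= i <-; rewrite lieDr.
Qed.

(** The map is [v |-> U^-1 g v]: by [g_lie] the bracket of two images is [U^-2 U g [v, w]]. A single
    exponent [n] serves all indices [m], which is the point of using sequences. *)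
Lemma taylor_morphism : exists (A : diffAlgType k) (f : {linear L -> Diff A}),
  lie_morphism f /\
  forall v, f v = 0 -> exists n, forall m, iter n (dmul (j m (u m))) (j m v) = 0.
Proof.
pose A : diffAlgType k := raw_quot (loc_raw U_linear U_mul U_der).
pose pi (p : H * nat) : A := raw_pi (loc_raw U_linear U_mul U_der) p.
have lf : linear (fun v => pi (g v, 1%N) : Diff A).
  move=> c v w; rewrite -[RHS]/(c *: raw_pi _ _ + raw_pi _ _ : A) -raw_piZ -raw_piD.
  apply/raw_piP; exists 0%N => /=.
  by rewrite g_linear (linear_funD U_linear (c *: g v)).
exists A, (fun_linear lf); split.
  move=> v w; rewrite !fun_linearE diff_lieE -scaleN1r /pi -!raw_pi_d -!raw_piM.
  rewrite -raw_piZ -raw_piD; apply/raw_piP; exists 0%N => /=.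
  by rewrite scaleN1r -!(linear_funD U_linear) g_lie.
move=> v /loc_pi_eq0[n e]; exists n => m.
have : iter n U (g v) m 0%N = 0 by rewrite e.
by move=> <-; elim: (n) => //= i ->.
Qed.

End Taylor.

(** * Polarization and non-vanishing of the derivations [std_der] *)

Section Pencils.
Variables (k : fieldType) (V : lmodType k).
Hypothesis char0 : [pchar k] =i pred0.

Lemma scaled_sum_eq0 n (c : nat -> V) :
  (forall t : k, \sum_(i < n) t ^+ i *: c i = 0) -> forall i, (i < n)%N -> c i = 0.
Proof.
elim: n c => // n IHn c sum0.
(* These are the coefficients of [P (2 t) - 2 ^ n P (t)], which has no term of degree [n]. *)
pose d i := (2 ^+ i - 2 ^+ n : k) *: c i.
have d0 i : (i < n)%N -> c i = 0.
  move=> lt_in; have /eqP : d i = 0.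
    apply: IHn lt_in => t.
    have e2 := sum0 (2 * t); have e1 : 2 ^+ n *: (\sum_(i < n.+1) t ^+ i *: c i) = 0.
      by rewrite sum0 scaler0.
    rewrite -[RHS](subrr 0) -[in X in X - _]e2 -[in X in _ - X]e1.
    rewrite scaler_sumr -sumrB big_ord_recr /= exprMn scalerA subrr addr0.
    apply: eq_bigr => l _; rewrite /d exprMn !scalerA -scalerBl.
    by congr (_ *: _); rewrite mulrBr !(mulrC (t ^+ _)).
  rewrite scaler_eq0 subr_eq0 -!natrX => /orP[/eqP e|/eqP //].
  have lt2 : (2 ^ i < 2 ^ n)%N by rewrite ltn_exp2l.
  have := natr_char0 char0 (2 ^ n - 2 ^ i).-1.
  by rewrite prednK ?subn_gt0 // natrB ?(ltnW lt2) // e subrr eqxx.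
move=> i; rewrite ltnS leq_eqVlt => /predU1P[->|]; last exact: d0.
have := sum0 1; rewrite big_ord_recr /= expr1n scale1r big1 ?add0r // => l _.
by rewrite (d0 l) ?scaler0.
Qed.
End Pencils.

Section DerivedPart.
Variables (k : fieldType) (L : st5_data k).
Local Notation E := (std_alg L).
Implicit Types (u v w x y : L) (f g h : E).

Let scaleAr c f g : c *: (f * g) = f * (c *: g).
Proof. by rewrite mulrC std_scaleAl mulrC. Qed.

(** The left side is the coefficient of [t] in the vanishing polynomial. *)
Lemma exp_pencil n (a b c d : E) :
  (forall t : k, (a + t *: b) ^+ n * (c + t *: d) = 0) ->
  a ^+ n * d + (a ^+ n.-1 * b * c) *+ n = 0.
Proof.
move=> h0; pose e i : E := a ^+ (n - i) * b ^+ i *+ 'C(n, i).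
have powE t : (a + t *: b) ^+ n = \sum_(i < n.+1) t ^+ i *: e i.
  rewrite exprDn; apply: eq_bigr => i _; rewrite /e -scalerMnr; congr (_ *+ _).
  rewrite scaleAr; congr (_ * _); elim: (i : nat) => [|j IHj]; first by rewrite !expr0 scale1r.
  by rewrite !exprS IHj -std_scaleAl -scaleAr scalerA.
pose s i : E := e i * c + (if i is j.+1 then e j * d else 0).
have s0 t : \sum_(i < n.+2) t ^+ i *: s i = 0.
  transitivity ((a + t *: b) ^+ n * (c + t *: d)); last exact: h0.
  rewrite mulrDr powE; under eq_bigr do rewrite /s scalerDr.
  rewrite big_split /=; congr (_ + _).
    rewrite big_ord_recr /= /e bin_small // mulr0n mul0r scaler0 addr0.
    by rewrite mulr_suml; apply: eq_bigr => i _; rewrite std_scaleAl.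
  rewrite big_ord_recl scaler0 add0r mulr_suml; apply: eq_bigr => i _.
  by rewrite /= -[bump 0 i]/(i.+1) add0n -std_scaleAl -scaleAr scalerA exprSr.
have := scaled_sum_eq0 (st5_char0 L) s0 (i := 1) isT.
rewrite /s /e subn0 bin0 expr0 mulr1 mulr1n bin1 expr1 subn1 addrC.
by rewrite mulrnAl.
Qed.

Definition std_kernel : set L := [set x | forall f, std_der x f = 0].

Lemma std_kernel_ideal : lie_ideal std_kernel.
Proof.
split; first split.
- by move=> f; rewrite (linear_fun0 (std_der_linear f)).
- by move=> c u v u0 v0 f; rewrite (std_der_linear f) u0 v0 scaler0 addr0.
move=> u x x0 f; rewrite std_der_lie !x0 subr0.
by apply: std_alg_eqP => w; rewrite std_derE !std_fun0 lie0r subr0.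
Qed.

(** Such an [x] is central in [std_kernel]: for [z] there, [[z, D v f y] = D z (D v f) y + D v f
    [z, y]], and the last term is [D [z, y] f v = 0]. The center is an abelian ideal. *)
Lemma std_kernel_std_der x v f y : std_kernel x -> x = std_der v f y -> x = 0.
Proof.
move=> x0 ex; have iK := std_kernel_ideal.
pose Z := [set z | std_kernel z /\ forall y, std_kernel y -> lie y z = 0].
have iZ : lie_ideal Z.
  split; first split.
  - by split=> [|z _]; [apply: subspace0; case: iK | rewrite lie0r].
  - move=> c z z' [Kz Zz] [Kz' Zz']; split; first by case: iK => -[_ D] _; apply: D.
    by move=> w Kw; rewrite lieDr lieZr Zz ?Zz' ?scaler0 ?addr0.
  move=> u z [Kz Zz]; split=> [|w Kw]; first exact: iK.2.
  have -> : lie w (lie u z) = lie u (lie w z) + lie (lie w u) z by lie_ring.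
  by rewrite !Zz ?lie0r ?addr0 //; exact: (lie_idealr _ iK Kw).
apply: (abelian_ideal_eq0 (@st5_semiprime _ L) iZ) => [z z' [Kz _] [_ Zz']|]; first exact: Zz'.
split=> // z Kz; rewrite ex.
have -> : lie z (std_der v f y) = std_der z (std_der v f) y + std_der v f (lie z y).
  by rewrite [in RHS]std_derE subrK.
rewrite Kz std_derC (lie_idealr _ iK Kz) !std_fun0 addr0.
by [].
Qed.

(* Polarization in [f] and in [u]; by proportionality all the terms of the linear coefficient
   coincide. *)
Lemma std_der_pow_eq0 n v :
  (forall u f g, std_der u f ^+ n * std_der v g = 0) -> forall g, std_der v g = 0.
Proof.
have char0 := st5_char0 L.
elim: n => [|n IHn] h0 g; first by have := h0 0 0 g; rewrite expr0 mul1r.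
apply: IHn => {g} u f g.
have h1 u1 f1 g1 : std_der u1 f1 ^+ n * (std_der u1 g1 * std_der v g) = 0.
  have := @exp_pencil n.+1 (std_der u1 f1) (std_der u1 g1) (std_der v g) 0.
  rewrite mulr0 add0r mulrA => /(_ _)/(mulrn_char0 char0); apply => t.
  by rewrite scaler0 addr0 -std_derZ -std_derD.
have h2 u1 g1 : std_der u f ^+ n * (std_der u1 g1 * std_der v g) = 0.
  have := @exp_pencil n (std_der u f) (std_der u1 f)
    (std_der u g1 * std_der v g) (std_der u1 g1 * std_der v g).
  rewrite (_ : _ * _ * _ *+ n = std_der u f ^+ n * (std_der u1 g1 * std_der v g) *+ n); last first.
    case: (n) => [|m]; rewrite ?mulr0n //=; congr (_ *+ _).
    rewrite exprSr -!mulrA; congr (_ * _); rewrite !mulrA; congr (_ * _).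
    exact: std_der_mulC.
  rewrite -mulrS => /(_ _)/(mulrn_char0 char0); apply => t.
  rewrite std_scaleAl -mulrDl.
  have D (x : E) : std_der u x + t *: std_der u1 x = std_der (t *: u1 + u) x.
    by rewrite (std_der_linear x) addrC.
  by rewrite !D h1.
(* Each value [x] of the product lies in [std_kernel], as [D x f1 u1 = D u1 f1 x] vanishes by [h2];
   being also a value of [D v g], it is zero. *)
apply: std_alg_eqP => w; rewrite mulrC std_funM.
apply: (@std_kernel_std_der _ v g) erefl => f1; apply: std_alg_eqP => u1.
by rewrite std_derC -!std_funM mulrC h2.
Qed.

(** The same [g] must occur in both factors, because the form [j x = D x g] involves only one
    operator. Polarizing in [g] reduces this to [std_der_pow_eq0]. *)
Lemma std_der_diag_neq0 n v f : std_der v f <> 0 ->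
  exists u g, std_der u g ^+ n * std_der v g <> 0.
Proof.
move=> vf; apply: contrapT => noex; apply: vf; move: f.
apply: (@std_der_pow_eq0 n) => u f g.
have h0 u1 f1 : std_der u1 f1 ^+ n * std_der v f1 = 0.
  by apply: contrapT => ne; apply: noex; exists u1, f1.
have := @exp_pencil n (std_der u f) (std_der u g) (std_der v f) (std_der v g).
rewrite (_ : _ * _ * _ *+ n = std_der u f ^+ n * std_der v g *+ n); last first.
  case: (n) => [|m]; rewrite ?mulr0n //=; congr (_ *+ _).
  by rewrite -mulrA (std_der_mulC u v g f) exprSr -mulrA (mulrC (std_der v g)).
rewrite -mulrS => /(_ _)/(mulrn_char0 (st5_char0 L)); apply => t.
by rewrite -!std_derZ -!std_derD.
Qed.

End DerivedPart.

(** * The kernel of all homomorphisms into special derivations *)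

(* The commutative algebra [E[s] / (s ^ 2 = eta)] over [E := std_alg L]. *)
Definition std_quad (k : fieldType) (L : st5_data k) (eta : std_alg L) : Type :=
  (std_alg L * std_alg L)%type.

Section StdQuad.
Variables (k : fieldType) (L : st5_data k) (eta : std_alg L).

HB.instance Definition _ := GRing.Lmodule.copy (std_quad eta) (std_alg L * std_alg L)%type.

Definition quad_mul (p q : std_quad eta) : std_quad eta :=
  (p.1 * q.1 + eta * (p.2 * q.2), p.1 * q.2 + p.2 * q.1).
(** The coefficients are constants; the derivation of the target is that of the Taylor parameter. *)
Definition quad_der (p : std_quad eta) : std_quad eta := 0.

Fact quad_mulC : commutative quad_mul.
Proof. by move=> p q; congr pair => /=; ring. Qed.
Fact quad_mulA : associative quad_mul.
Proof. by move=> p q r; congr pair => /=; ring. Qed.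
Fact quad_mul_linear q : linear (quad_mul^~ q).
Proof.
have sE (a : k) (f : std_alg L) : a *: f = a *: (1 : std_alg L) * f by rewrite -std_scaleAl mul1r.
move=> c p r; rewrite /quad_mul; congr pair => /=; rewrite scalerDr.
  rewrite (sE c p.1) (sE c p.2) (sE c (p.1 * q.1)) (sE c (eta * _)).
  by move: (c *: (1 : std_alg L)) => a; ring.
rewrite (sE c p.1) (sE c p.2) (sE c (p.1 * q.2)) (sE c (p.2 * q.1)).
by move: (c *: (1 : std_alg L)) => a; ring.
Qed.
Fact quad_der_linear : linear quad_der.
Proof. by move=> c p q; rewrite /quad_der scaler0 addr0. Qed.
Fact quad_derM p q : quad_der (quad_mul p q) = quad_mul (quad_der p) q + quad_mul p (quad_der q).
Proof. by rewrite /quad_der /quad_mul /=; congr pair => /=; ring. Qed.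

HB.instance Definition _ := isDiffAlgebra.Build k (std_quad eta)
  quad_mulC quad_mulA quad_mul_linear quad_der_linear quad_derM.

Lemma quad_iter_mul n f g h :
  iter n (dmul ((f, 0) : std_quad eta)) (g, h) = (f ^+ n * g, f ^+ n * h).
Proof.
elim: n => [|n IHn] /=; first by rewrite expr0 !mul1r.
by rewrite IHn /dmul /= /quad_mul /= exprS; congr pair; ring.
Qed.

End StdQuad.

Section CommonKernel.
Variables (k : fieldType) (L : lieAlgType k).

Definition diff_kernel : set L := [set v | forall (A : diffAlgType k)
  (f : {linear L -> Diff A}), lie_morphism f -> f v = 0].

Lemma diff_kernel_ideal : lie_ideal diff_kernel.
Proof.
split; first split.
- by move=> A f mf; rewrite linear0.
- by move=> c u v u0 v0 A f mf; rewrite linearP u0 // v0 // scaler0 addr0.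
by move=> u v v0 A f mf; rewrite mf v0 // diff_lieE der0 dmul0r dmul0r subrr.
Qed.
End CommonKernel.

Section KernelPart.
Variables (k : fieldType) (L : st5_data k).
Local Notation E := (std_alg L).
Implicit Types (u v w x y z : L) (f g h : E).
Local Notation I1 := (@std_kernel k L).
Local Notation K := (@diff_kernel k L).

Lemma diff_kernel_sub v : K v -> I1 v.
Proof.
move=> Kv f; apply: contrapT => vf.
(* The n-th choice survives the n-th power. A kernel element would be killed by one exponent [n] at
   all indices, which fails at index [n]. *)
have /choice[s sP] : forall n, exists p : L * E,
    std_der p.1 p.2 ^+ n * std_der v p.2 <> 0.
  by move=> n; have [u [g ug]] := std_der_diag_neq0 n vf; exists (u, g).
pose j n x : std_quad (0 : E) := (std_der x (s n).2, 0).
have lj n : linear (j n).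
  move=> c x y; rewrite /j (std_der_linear (s n).2); congr pair => /=.
  by rewrite scaler0 addr0.
have [n x y z|A [g [mg /(_ v)]]] := @taylor_morphism _ _ _ j (fun n => (s n).1) lj.
  rewrite /j /dmul /= /quad_mul /=; congr pair => /=; last by ring.
  rewrite !std_der_lie.
  move: (s n).2 => F.
  have e x1 y1 z1 :
      std_der x1 F * std_der y1 (std_der z1 F) = std_der y1 F * std_der x1 (std_der z1 F).
    exact: std_der_mulC.
  rewrite !mulrBr (e x y z) (e x z y) (e y z x).
  ring.
case=> [|n /(_ n)]; first exact: Kv.
by rewrite quad_iter_mul => /(congr1 fst)/sP.
Qed.

(** * The action of [std_alg] on [std_kernel] by centroid elements *)

Section Fixed.
Variables (x : L) (f : E).
Hypothesis Ix : I1 x.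
(** The defect is [D u f x = D x f u = 0]. *)
Lemma std_kernel_lier u : lie u (f x) = f (lie u x).
Proof. by apply: subr0_eq; rewrite -std_derE std_derC Ix std_fun0. Qed.
Lemma std_kernel_liel u : lie (f u) x = f (lie u x).
Proof.
rewrite lieC (lieC u) (linear_funN (std_fun_linear f)); congr (- _).
by apply: subr0_eq; rewrite -std_derE Ix std_fun0.
Qed.
Lemma std_kernel_fun : I1 (f x).
Proof.
move=> g; apply: std_alg_eqP => u.
by rewrite std_derC -std_funM mulrC std_funM std_derC Ix std_fun0 (linear_fun0 (std_fun_linear f)).
Qed.
End Fixed.

(** The elements [f y] with [y] in [std_kernel] and [f (f y) = 0] form an ideal, and it is abelian
    since [[f y, f z] = [y, f (f z)] = 0]. *)
Lemma std_kernel_reduced f x : I1 x -> f (f x) = 0 -> f x = 0.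
Proof.
move=> Ix ffx; have [[I10 I1D] I1l] := @std_kernel_ideal k L.
have lf := std_fun_linear f.
pose M := [set z | exists y, [/\ I1 y, f (f y) = 0 & z = f y]].
have iM : lie_ideal M.
  split; first split.
  - by exists 0; split; rewrite ?(linear_fun0 lf).
  - move=> c _ _ [y [Iy fy ->]] [z [Iz fz ->]]; exists (c *: y + z).
    by split; rewrite ?lf ?fy ?fz ?scaler0 ?addr0 //; apply: I1D.
  move=> u _ [y [Iy fy ->]]; exists (lie u y); split; [exact: I1l| |exact: std_kernel_lier].
  by rewrite -!std_kernel_lier ?fy ?lie0r //; apply: std_kernel_fun.
apply: (abelian_ideal_eq0 (@st5_semiprime _ L) iM) => [|]; last by exists x.
move=> _ _ [y [Iy fy ->]] [z [Iz fz ->]].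
rewrite std_kernel_lier // std_kernel_liel // -!std_kernel_lier ?fz ?lie0r //.
exact: std_kernel_fun.
Qed.

Lemma std_kernel_pow f n x : I1 x -> (f ^+ n.+1) x = 0 -> f x = 0.
Proof.
move=> Ix; elim: n => [|n IHn]; first by rewrite expr1.
rewrite 2!exprS !std_funM => /(std_kernel_reduced (std_kernel_fun _ Ix)).
by rewrite -std_funM -exprS.
Qed.

Lemma std3_cyc x y z : std3 y z x = std3 x y z.
Proof. by apply: std_alg_eqP => w /=; rewrite /lie_std3; lie_ring. Qed.
Lemma std3_swap x y z : std3 y x z = - std3 x y z.
Proof. by apply: std_alg_eqP => w; rewrite std_funN /= /lie_std3; lie_ring. Qed.
Lemma std3_linear x y : linear (fun z => std3 x y z).
Proof.
move=> c u v; apply: std_alg_eqP => w; rewrite std_funD std_funZ /= /lie_std3.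
rewrite !(lieDl, lieDr, lieZl, lieZr, scalerDr).
lie_ring.
Qed.
Lemma std3_xx x y : std3 x x y = 0.
Proof. by apply: std_alg_eqP => w; rewrite std_fun0 /= /lie_std3 lie_xx; lie_ring. Qed.


(* On [I1], the operator [std3 a b x] depends [E]-linearly on the restriction of [ad x]. *)
Lemma std3_transfer a b x f e1 e2 e3 f1 f2 f3 : I1 a -> I1 b ->
  (forall y, I1 y -> f (lie x y) = f1 (lie e1 y) + f2 (lie e2 y) + f3 (lie e3 y)) ->
  forall w, I1 w -> f (std3 a b x w) =
    f1 (std3 a b e1 w) + f2 (std3 a b e2 w) + f3 (std3 a b e3 w).
Proof.
move=> Ia Ib fx w Iw; have [_ I1l] := @std_kernel_ideal k L.
have lf := std_fun_linear.
have E g z : g (std3 a b z w) = lie (lie a b) (g (lie z w))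
    - lie (g (lie z b)) (lie a w) + lie (g (lie z a)) (lie b w).
  rewrite /= /lie_std3 !(linear_funD (lf _ _ g)) (lieC b z) lieNl (linear_funN (lf _ _ g)).
  rewrite -(std_kernel_lier _ (I1l z w Iw)) -(std_kernel_liel _ (I1l a w Iw)).
  by rewrite -(std_kernel_liel _ (I1l b w Iw)).
rewrite !E !fx // !lieDr !lieDl; lie_ring.
Qed.

(** On [std_kernel], [tau ^+ 2] times [ad [y, z]] is the commutator of the operators [tau ad y] and
    [tau ad z]; the coefficients commute with brackets and collect into 2x2 minors. *)
Lemma split_form_bracket (a b c : L) (tau : E) (al be ga : L -> E) y z w :
  I1 a -> I1 b -> I1 c -> I1 w ->
  (forall x w', I1 w' ->
     tau (lie x w') = al x (lie a w') + be x (lie b w') + ga x (lie c w')) ->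
  (tau ^+ 2) (lie (lie y z) w) =
    (al y * be z - be y * al z) (lie (lie a b) w)
  + (be y * ga z - ga y * be z) (lie (lie b c) w)
  + (ga y * al z - al y * ga z) (lie (lie c a) w).
Proof.
move=> Ia Ib Ic Iw ad_tau; have [_ I1l] := @std_kernel_ideal k L.
have lf (f : E) := std_fun_linear f.
have e2 u v : tau (tau (lie u (lie v w))) =
      (al u * al v) (lie a (lie a w)) + (al u * be v) (lie a (lie b w))
    + (al u * ga v) (lie a (lie c w)) + (be u * al v) (lie b (lie a w))
    + (be u * be v) (lie b (lie b w)) + (be u * ga v) (lie b (lie c w))
    + (ga u * al v) (lie c (lie a w)) + (ga u * be v) (lie c (lie b w))
    + (ga u * ga v) (lie c (lie c w)).
  have h t : tau (lie t (lie v w)) = al v (lie t (lie a w))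
      + be v (lie t (lie b w)) + ga v (lie t (lie c w)).
    rewrite -std_kernel_lier; last exact: I1l.
    by rewrite ad_tau // !lieDr !std_kernel_lier //; apply: I1l.
  rewrite ad_tau; last exact: I1l.
  rewrite !(linear_funD (lf tau)).
  rewrite -[tau (al u _)]std_funM -[tau (be u _)]std_funM -[tau (ga u _)]std_funM.
  rewrite !(mulrC tau) !std_funM !h !(linear_funD (lf _)).
  by rewrite !addrA.
rewrite expr2 std_funM (lie_derl y) !(linear_funB (lf tau)) !e2.
rewrite !(std_funD, std_funN) !lie_derl !(linear_funB (lf _)).
rewrite !(mulrC (al z)) !(mulrC (be z)) !(mulrC (ga z)).
by rewrite !std_funM; lie_ring.
Qed.

(** * Coordinates in a basis [a], [b], [[a, b]] and isotropic forms *)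

Section SplitForm.
Variables (a b : L).
Hypotheses (Ia : I1 a) (Ib : I1 b).
Let c := lie a b.
Let Ic : I1 c. Proof. by case: (@std_kernel_ideal k L) => _; apply. Qed.
Let tau : E := std3 a b c.
(* [al x], [be x], [ga x] are [tau] times the coordinates of [x] with respect to [a, b, c]. *)
Let al x : E := std3 b c x.
Let be x : E := std3 c a x.
Let ga x : E := std3 a b x.

Let ad_tau x y : I1 y ->
  tau (lie x y) = al x (lie a y) + be x (lie b y) + ga x (lie c y).
Proof.
move=> Iy; have := std3_exchange a b c x y.
rewrite (std3_swap c a x) std_funN lieNr !std_kernel_lier // => e.
by apply: subr0_eq; rewrite -[RHS]oppr0 -e -/(al x) -/(be x) -/(ga x) -/tau; lie_ring.
Qed.

Let P y z := al y * be z - be y * al z.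
Let Q y z := be y * ga z - ga y * be z.
Let S y z := ga y * al z - al y * ga z.

(** By this inclusion, identities valid on [std_kernel] hold on all of [L] after one more factor
    [tau]; hence the exponent 3 in [transfer]. *)
Let tau_kernel w : I1 (tau w).
Proof.
have [[I10 I1D] I1l] := @std_kernel_ideal k L.
have D x y : I1 x -> I1 y -> I1 (x + y) by move=> Ix Iy; rewrite -[x]scale1r; apply: I1D.
have I1r x y : I1 x -> I1 (lie x y) by move=> Ix; apply: (lie_idealr y (@std_kernel_ideal k L)).
by apply: (D); [apply: D|]; apply: I1r; apply: I1l.
Qed.

Let transfer p q y z : I1 p -> I1 q -> tau ^+ 3 * std3 p q (lie y z) =
  tau * (P y z * std3 p q c + Q y z * std3 p q (lie b c) + S y z * std3 p q (lie c a)).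
Proof.
move=> Ip Iq; rewrite [RHS]mulrC.
have -> : tau ^+ 3 * std3 p q (lie y z) = tau ^+ 2 * std3 p q (lie y z) * tau by ring.
apply: std_alg_eqP => w; rewrite 2!std_funM.
have h v : I1 v -> (tau ^+ 2) (lie (lie y z) v) =
    P y z (lie c v) + Q y z (lie (lie b c) v) + S y z (lie (lie c a) v).
  by move=> Iv; apply: split_form_bracket.
by rewrite (std3_transfer Ip Iq h (tau_kernel w)) !std_funD !std_funM.
Qed.

(** As [a] lies in [std_kernel], [D a] kills [std3 a b c], and in the Leibniz expansion only [std3 a
    b [a, c]] remains. *)
Let ga_ca : ga (lie c a) = 0.
Proof.
have := std3_der a a b c; rewrite Ia lie_xx -/c.
rewrite -(std3_cyc (0 : L)) (linear_fun0 (std3_linear b c)) add0r.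
rewrite -std3_cyc std3_xx add0r => /esym e.
by rewrite /ga (lieC c a) (linear_funN (std3_linear a b)) e oppr0.
Qed.

Let ga_bc : ga (lie b c) = 0.
Proof.
have := std3_der b a b c; rewrite Ib lie_xx (lieC b a) -/c.
rewrite -(std3_cyc (- c)) (linear_funN (std3_linear b c)) std3_cyc.
rewrite (_ : std3 c b c = 0); last by rewrite std3_cyc std3_xx.
rewrite oppr0 add0r -(std3_cyc a) -(std3_cyc (0 : L)) (linear_fun0 (std3_linear c a)).
by rewrite add0r => /esym.
Qed.

Let be_b : be b = tau. Proof. by rewrite /be -std3_cyc. Qed.
Let ga_b : ga b = 0. Proof. by rewrite /ga -std3_cyc std3_xx. Qed.
Let be_c : be c = 0. Proof. by rewrite /be std3_cyc std3_xx. Qed.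

Let kappa := be (lie c a).
(* With this [eta = s ^ 2], [j x := tau ^ 2 * (tau * be x + s * ga x)] satisfies
   [j b j [c, a] + j c j [a, b] = 0], that is, [j] is isotropic; note that [j a = 0]. *)
Let eta := - tau * kappa.
Let j x : std_quad eta := (tau ^+ 3 * be x, tau ^+ 2 * ga x).

Let j_linear : linear j.
Proof.
move=> t x y; rewrite /j /be /ga (std3_linear c a) (std3_linear a b) !mulrDr.
by congr pair => /=; congr (_ + _); rewrite mulrC -std_scaleAl mulrC.
Qed.

Let tau3_be y z : tau ^+ 3 * be (lie y z) = tau * (Q y z * be (lie b c) + S y z * kappa).
Proof. by rewrite transfer // -!/(be _) be_c mulr0 add0r. Qed.

Let tau3_ga y z : tau ^+ 3 * ga (lie y z) = tau * (P y z * tau).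
Proof. by rewrite transfer // -!/(ga _) ga_ca ga_bc !mulr0 !addr0. Qed.

(** In the cyclic sum, a coordinate times a minor gives a 3x3 determinant in [al], [be], [ga]. All
    have a repeated row except those of [be S] and [ga P], which are equal and cancel by the choice
    of [eta]. *)
Let j_lie x y z :
  dmul (j x) (j (lie y z)) + dmul (j y) (j (lie z x)) + dmul (j z) (j (lie x y)) = 0.
Proof.
have d1 u v w : (dmul (j u) (j (lie v w))).1 =
    tau ^+ 4 * (be u * (Q v w * be (lie b c) + S v w * kappa) - kappa * ga u * P v w).
  rewrite /dmul /= (_ : _ + _ = tau ^+ 3 * be u * (tau ^+ 3 * be (lie v w))
    - tau ^+ 2 * kappa * ga u * (tau ^+ 3 * ga (lie v w))); last by rewrite /eta; ring.
  by rewrite tau3_be tau3_ga; ring.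
have d2 u v w : (dmul (j u) (j (lie v w))).2 =
    tau ^+ 3 * (tau * be u * P v w + ga u * (Q v w * be (lie b c) + S v w * kappa)).
  rewrite /dmul /= (_ : _ + _ = tau ^+ 2 * (be u * (tau ^+ 3 * ga (lie v w)))
    + tau ^+ 2 * ga u * (tau ^+ 3 * be (lie v w))); last by ring.
  by rewrite tau3_be tau3_ga; ring.
have d u v w : dmul (j u) (j (lie v w)) = (
    tau ^+ 4 * (be u * (Q v w * be (lie b c) + S v w * kappa) - kappa * ga u * P v w),
    tau ^+ 3 * (tau * be u * P v w + ga u * (Q v w * be (lie b c) + S v w * kappa))).
  by rewrite -d1 -d2; case: (dmul _ _).
by rewrite !d /P /Q /S; congr pair => /=; ring.
Qed.

(** Since [j b = tau ^+ 4], membership in the kernel kills the coordinates of [v] up to a power of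
    [tau], which [std_kernel_pow] lowers to one. *)
Lemma diff_kernel_split v w : K v -> I1 w ->
  tau (be v w) = 0 /\ tau (ga v w) = 0.
Proof.
move=> Kv Iw.
have [A [f [mf /(_ v)]]] := @taylor_morphism _ _ _ (fun _ => j) (fun _ => b)
  (fun _ => j_linear) (fun _ => j_lie).
case=> [|n /(_ 0%N)]; first exact: Kv.
have -> : j b = (tau ^+ 4, 0) by rewrite /j be_b ga_b mulr0 -exprSr.
rewrite quad_iter_mul => e.
have [e1 e2] := (congr1 fst e, congr1 snd e); rewrite /= in e1 e2.
split.
  apply: (@std_kernel_pow _ (4 * n + 2)); first exact: std_kernel_fun.
  by rewrite -std_funM -addnS exprD exprM -mulrA e1.
apply: (@std_kernel_pow _ (4 * n + 1)); first exact: std_kernel_fun.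
by rewrite -std_funM -addnS exprD exprM -mulrA e2.
Qed.

(** After multiplication by [tau], only the [a]-coordinate of an element of [diff_kernel] survives.
    So [v] and [w] both act like multiples of [a], and [[a, a] = 0]. *)
Lemma diff_kernel_std3 v w : K a -> K v -> K w -> tau (lie v w) = 0.
Proof.
move=> Ka Kv Kw; have [Iv Iw] := (diff_kernel_sub Kv, diff_kernel_sub Kw).
have [_ I1l] := @std_kernel_ideal k L.
have tau2 x y : K x -> I1 y -> tau (tau (lie x y)) = al x (tau (lie a y)).
  move=> Kx Iy; have lt := std_fun_linear tau.
  rewrite ad_tau // (linear_funD lt (_ + _)) (linear_funD lt (al x _)).
  rewrite (diff_kernel_split Kx (I1l b y Iy)).1.
  rewrite (diff_kernel_split Kx (I1l c y Iy)).2 !addr0.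
  by rewrite -!std_funM mulrC.
apply: (@std_kernel_pow _ 3); first exact: I1l.
rewrite 3!exprS expr1 !std_funM tau2 // -[tau (al v _)]std_funM mulrC std_funM.
have lt := std_fun_linear tau.
rewrite (lieC a w) (linear_funN lt (lie w a)) (linear_funN lt (tau _)) tau2 // lie_xx.
by rewrite !(linear_fun0 (std_fun_linear _)) oppr0 !(linear_fun0 (std_fun_linear _)).
Qed.

End SplitForm.

(* [q a b c d] has the symmetries of a curvature tensor and its sectional curvatures
   [q a b a b] vanish. *)
Lemma diff_kernel_std3_derived a b c d v w : K a -> K b -> K c -> K d -> K v -> K w ->
  std3 a b (lie c d) (lie v w) = 0.
Proof.
move=> Ka Kb Kc Kd Kv Kw.
pose q a b c d := std3 a b (lie c d) (lie v w).
have [[K0 KD] Kl] := @diff_kernel_ideal k L.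
have Kadd x y : K x -> K y -> K (x + y) by move=> Kx Ky; rewrite -[x]scale1r; apply: KD.
have sub := diff_kernel_sub.
have q0 x y : K x -> K y -> q x y x y = 0.
  by move=> Kx Ky; apply: diff_kernel_std3 => //; exact: sub.
have q12 x y z t : q y x z t = - q x y z t by rewrite /q std3_swap std_funN.
have q34 x y z t : q x y t z = - q x y z t.
  by rewrite /q (lieC t z) (linear_funN (std3_linear x y)) std_funN.
have q12D x x' y z t : q (x + x') y z t = q x y z t + q x' y z t.
  by rewrite /q -!(std3_cyc _ y) (linear_funD (std3_linear y _)) std_funD.
have q34D x y z z' t : q x y (z + z') t = q x y z t + q x y z' t.
  by rewrite /q lieDl (linear_funD (std3_linear x y)) std_funD.
(* This is the Leibniz expansion of [D z (std3 x y t) = 0]. *)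
have qJ x y z t : K z -> q y t z x - q x t z y + q x y z t = 0.
  move=> Kz; have := std3_der z x y t; rewrite (sub _ Kz (std3 x y t)).
  rewrite -(std3_cyc (lie z x)) -(std3_cyc x) -(std3_cyc (lie z y)) (std3_swap x t).
  by move/(congr1 (fun f : E => f (lie v w))); rewrite !std_funD std_funN std_fun0 => <-.
have q33 x y z : q x y z z = 0.
  by rewrite /q lie_xx (linear_fun0 (std3_linear x y)).
have qE : q a b c d = std3 a b (lie c d) (lie v w) by [].
rewrite -{}qE; clearbody q.
have q2D x y y' z t : q x (y + y') z t = q x y z t + q x y' z t.
  by rewrite q12 q12D opprD -(q12 y) -(q12 y').
have q4D x y z t t' : q x y z (t + t') = q x y z t + q x y z t'.
  by rewrite q34 q34D opprD -(q34 x y t) -(q34 x y t').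
have qs x y z : K x -> K y -> K z -> q x y z y = 0.
  (* Polarizing [q0] in [x] gives [e1]; by [e2] its two terms are equal. *)
  move=> Kx Ky Kz.
  have e1 : q x y z y + q z y x y = 0.
    have := q0 (x + z) y (Kadd _ _ Kx Kz) Ky; rewrite q12D !q34D (q0 x) // (q0 z) //.
    by rewrite add0r addr0.
  have e2 : q y z y x = q y x y z.
    by have := qJ y z y x Ky; rewrite q33 sub0r addrC => /subr0_eq.
  apply: (mulrn_char0 (st5_char0 L) (n := 1)); rewrite -e1 mulr2n; congr (_ + _).
  by rewrite q12 q34 opprK -e2 q12 q34 opprK.
have qt x y z t : K x -> K y -> K z -> K t -> q x t z y = - q x y z t.
  move=> Kx Ky Kz Kt; apply/eqP; rewrite -addr_eq0 addrC; apply/eqP.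
  have := qs x (y + t) z Kx (Kadd _ _ Ky Kt) Kz.
  by rewrite q2D !q4D (qs x y) // (qs x t) // add0r addr0.
(* By the symmetries, each of the three terms of [qJ a b c d] equals [q a b c d]. *)
apply: (mulrn_char0 (st5_char0 L) (n := 2)); rewrite -(qJ a b c d Kc).
rewrite (q12 d b) (qt d a c b) // (q12 a d) (qt a b c d) //.
by rewrite !opprK !mulrS mulr0n; lie_ring.
Qed.

(** By [lie2_std3], brackets [[[p, q], [r, s]]] in the kernel commute with its derived algebra,
    hence vanish; a metabelian ideal is zero. *)
Lemma diff_kernel_eq0 v : K v -> v = 0.
Proof.
move=> Kv; have iK := @diff_kernel_ideal k L.
have Kl x y : K y -> K (lie x y) by case: iK => _; apply.
have st := @st5_semiprime _ L.
apply: (metabelian_ideal_eq0 st iK Kv) => p q r s Kp Kq Kr Ks.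
apply: (centralizer_derived_eq0 st iK) => [|a b Ka Kb].
  by apply: (Kl); apply: Kl.
apply: (mulrn_char0 (st5_char0 L) (n := 1)); rewrite lie2_std3.
by rewrite !diff_kernel_std3_derived // subrr.
Qed.

End KernelPart.

Theorem corollary2 (k : fieldType) (L : lieAlgType k)
    (char0 : [pchar k] =i pred0)
    (semiprimeL : lie_semiprime L)
    (St5 : standard_lie_identity5 L) :
  (exists (A : diffAlgType k) (f : {linear L -> Diff A}),
     [/\ diff_semiprime A, lie_morphism f & injective f])
  /\ wronskian_special L.
Proof.
pose X := St5Data char0 semiprimeL St5.
have inj : injective (wiota L).
  apply: wiota_inj => x x0; apply: contrapT => noA; apply: x0.
  apply: (@diff_kernel_eq0 k X) => A f mf; apply: contrapT => fx.
  by apply: noA; exists A, f.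
split; last by exists (wenvelope L), (wiota L); split=> //; apply: wenvelopeP.
exact: (semiprime_embedding semiprimeL (@wiota_morphism k L) inj).
Qed.
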